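(* Let $d\ge2$, $S^d=\{x\in\mathbb{R}^d;\|x\|=1\}$ and $A_{d-1}=2\pi^{d/2}/\Gamma(d/2)$. For $0\le\rho<1$ and $\eta\in S^d$, let $\operatorname{Exit}_d(\rho\eta)$ denote the distribution on $S^d$ with density $\frac{1}{A_{d-1}}\frac{1-\rho^2}{\|x-\rho\eta\|^d}$ with respect to surface measure. Suppose $X\mid\xi\sim\operatorname{Exit}_d(\rho_1\xi)$ with known $\rho_1\in[0,1)$, and the prior distribution of $\xi\in S^d$ is $\operatorname{Exit}_d(\rho_2\eta_2)$ with $\rho_2\in[0,1)$, $\eta_2\in S^d$. Then for $\eta_1\in S^d$, the posterior distribution of $\xi$ given $X=\eta_1$ has density $$f(\xi)=\frac{1}{A_{d-1}}\frac{(1+\rho_1^2\rho_2^2-2\rho_1\rho_2\eta_1'\eta_2)^{d/2}}{1-\rho_1^2\rho_2^2}\frac{1-\rho_1^2}{\|\xi-\rho_1\eta_1\|^d}\frac{1-\rho_2^2}{\|\xi-\rho_2\eta_2\|^d},\qquad\xi\in S^d.$$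
   Context: In this paper $S^d$ denotes the unit sphere in $\mathbb{R}^d$. *)

(* Defs.v *)
From HB Require Import structures.
From mathcomp Require Import all_boot all_order all_algebra.
From mathcomp Require Import all_classical all_reals all_analysis.
Set Implicit Arguments. Unset Strict Implicit. Unset Printing Implicit Defensive.
Import Order.TTheory GRing.Theory Num.Theory.
Import numFieldNormedType.Exports.
Local Open Scope classical_set_scope.
Local Open Scope ring_scope.

Section Defs.
Variable R : realType.

Definition dotp (d : nat) (x y : 'I_d -> R) : R := \sum_(i < d) x i * y i.
Definition enorm (d : nat) (x : 'I_d -> R) : R := Num.sqrt (dotp x x).
Definition subsc (d : nat) (x : 'I_d -> R) (r : R) (y : 'I_d -> R) : 'I_d -> R :=
  fun i => x i - r * y i.
Definition scalev (d : nat) (r : R) (x : 'I_d -> R) : 'I_d -> R := fun i => r * x i.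

Definition sphere (d : nat) : set ('I_d -> R) := [set x | enorm x = 1].

Definition vcons (n : nat) (a : R) (v : 'I_n -> R) : 'I_n.+1 -> R :=
  fun i => match unlift ord0 i with Some j => v j | None => a end.

(* Lebesgue integral over R^n of a [0,+oo]-valued function, as the iterated
   one-dimensional Lebesgue integral (Tonelli). *)
Fixpoint lebint (n : nat) : (('I_n -> R) -> \bar R) -> \bar R :=
  match n with
  | 0 => fun f => f (fun _ => 0)
  | n'.+1 => fun f =>
      (\int[@lebesgue_measure R]_(a in [set: R]) lebint (fun v => f (vcons a v)))%E
  end.

(* Integral against the surface measure sigma of S^d, where (Folland,
   Real Analysis, Thm 2.49) sigma(E) = d * Leb({r x : 0 < r <= 1, x in E});
   hence int_S g dsigma = d * int_{0 < |x| <= 1} g(x/|x|) dx. *)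
Definition sphere_int (d : nat) (g : ('I_d -> R) -> \bar R) : \bar R :=
  ((d%:R)%:E * lebint (fun x => if ((0 < enorm x) && (enorm x <= 1))%R
                               then g (scalev (enorm x)^-1 x) else 0%E))%E.

Definition Gammaf (s : R) : R :=
  \int[@lebesgue_measure R]_(t in `]0%R, +oo[%classic) (t `^ (s - 1) * expR (- t)).

Definition Asurf (d : nat) : R := 2 * pi `^ (d%:R / 2) / Gammaf (d%:R / 2).

Definition exit_density (d : nat) (rho : R) (eta : 'I_d -> R) (x : 'I_d -> R) : R :=
  (Asurf d)^-1 * ((1 - rho ^+ 2) / enorm (subsc x rho eta) ^+ d).

(* Bayes: lik xi x = density (w.r.t. sigma) of X at x given xi;
   prior xi = prior density of xi (w.r.t. sigma). *)
Definition marginal_density (d : nat) (lik : ('I_d -> R) -> ('I_d -> R) -> R)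
  (prior : ('I_d -> R) -> R) (x : 'I_d -> R) : \bar R :=
  sphere_int (fun xi => (lik xi x * prior xi)%:E).

Definition posterior_density (d : nat) (lik : ('I_d -> R) -> ('I_d -> R) -> R)
  (prior : ('I_d -> R) -> R) (x : 'I_d -> R) (xi : 'I_d -> R) : R :=
  lik xi x * prior xi / fine (marginal_density lik prior x).

End Defs.

(* Main.v *)
(** Write [L1 = 1 + rho1^2 - 2 rho1 eta1.x] and [L2] likewise for the squared
    distances from [x] on the sphere to [rho1 eta1] and [rho2 eta2]; everything
    reduces to the integral of [(L1 L2)^(-d/2)] over the sphere.  Up to a
    constant this function is [int_R (e^t L1 + e^-t L2)^-d dt], and for fixed
    [t] the integrand has the form [(a - b.x)^-d].  In polar coordinates
    [int_S (a - b.x)^-d = d vol {x | a |x| - b.x <= 1}], the volume of an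
    ellipsoid with a focus at the origin, namely
    [A a / (a^2 - |b|^2)^((d+1)/2)].  The remaining integral in [t] is
    elementary (substitute [w = e^t - e^-t]), and all constants are fixed by the
    case [rho1 = rho2 = 0].  Polar coordinates themselves are obtained from the
    invariance of [ds/s] under dilations. *)

Require Import Defs.
From HB Require Import structures.
From mathcomp Require Import all_boot all_order all_algebra.
From mathcomp Require Import all_classical all_reals all_analysis.
From mathcomp Require Import measurable_realfun ring lra.
Import Order.TTheory GRing.Theory Num.Theory.
Import numFieldNormedType.Exports.
Local Open Scope classical_set_scope.
Local Open Scope ring_scope.

(** * Affine changes of variable on the line *)

Section affine_change_of_variable.
Context {R : realType}.
Local Notation mu := (@lebesgue_measure R).

(** The surface integral is given only as [d] times an integral over the unit ball, itself iterated
    in the coordinates, so neither rotations nor a radial-angular decomposition is at hand. They are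
    replaced by a comparison of gauges: if [H] is homogeneous of degree [-n], then [H x dx] is
    invariant under dilations, and the gauge that cuts off the integral, [|x|] or [a |x| - b.x], can
    be exchanged for the other. The parameter [t] is introduced because [L1 L2] involves two
    directions at once, while [e^t L1 + e^-t L2] is affine in [x] on the sphere and involves a
    single vector [b]. With [p = 1 - rho1^2] and [q = 1 - rho2^2], its discriminant [a^2 - |b|^2]
    equals [(e^t p - e^-t q)^2 + 4 D], where [D = |eta1 - rho1 rho2 eta2|^2]. Up to a shift of [t]
    the first term is the square of a multiple of [e^t - e^-t], which is why the substitution
    succeeds. *)

Definition affine (c e : R) : R -> measurableTypeR R := fun x => c * x + e.

Lemma measurable_affine (c e : R) : measurable_fun setT (affine c e).
Proof. by apply: measurable_funD => //; apply: measurable_funM. Qed.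

Definition affine_image (c e : R) : {measure set (measurableTypeR R) -> \bar R} :=
  measure_function_pushforward__canonical__measure_function_Measure mu
    (measurable_affine c e).

Lemma lebesgue_measure_affine (c e : R) (c0 : 0 < c) (A : set R) :
  measurable A -> mu A = mscale (NngNum (ltW c0)) (affine_image c e) A.
Proof.
move=> mA; apply: lebesgue_measure_unique => //= _ [[a b]] _ <-.
rewrite /mscale /= /pushforward/=.
have -> : affine c e @^-1` `]a, b] = `](a - e) / c, (b - e) / c]%classic.
  apply/seteqP; split => x /=; rewrite /affine !in_itv/= ltr_pdivrMr// ler_pdivlMr//.
    by rewrite ltrBlDr lerBrDr (mulrC x).
  by rewrite ltrBlDr lerBrDr (mulrC x).
rewrite !lebesgue_measure_itv/= !lte_fin ltr_pM2r ?invr_gt0// ltrD2r.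
case: ifP => _; last by rewrite mule0.
rewrite -!EFinB -EFinM; congr EFin.
by field; rewrite gt_eqF.
Qed.

Lemma integral_affine (c e : R) (f : R -> \bar R) : 0 < c ->
  measurable_fun [set: R] f -> (forall x, 0 <= f x)%E ->
  (\int[mu]_x f (c * x + e)%R = (c^-1)%:E * \int[mu]_x f x)%E.
Proof.
move=> c0 mf f0.
have -> : (\int[mu]_x f x =
    \int[mscale (NngNum (ltW c0)) (affine_image c e)]_x f x)%E.
  apply: eq_measure_integral => A mA _.
  exact: (lebesgue_measure_affine c e c0).
rewrite ge0_integral_mscale//= muleA -EFinM mulVf ?gt_eqF// mul1e.
by rewrite ge0_integral_pushforward//; exact: measurable_affine.
Qed.

Lemma integral_reflection (f : R -> \bar R) :
  measurable_fun [set: R] f -> (forall x, 0 <= f x)%E ->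
  (\int[mu]_x f (- x)%R = \int[mu]_x f x)%E.
Proof.
move=> mf f0.
rewrite [RHS](_ : _ = \int[pushforward mu (-%R : R -> measurableTypeR R)]_x f x)%E.
  by rewrite ge0_integral_pushforward.
by apply: eq_measure_integral => A mA _; exact/esym/lebesgue_measureN.
Qed.

Lemma integral_translation (e : R) (f : R -> \bar R) :
  measurable_fun [set: R] f -> (forall x, 0 <= f x)%E ->
  (\int[mu]_x f (x + e)%R = \int[mu]_x f x)%E.
Proof.
move=> mf f0; rewrite -[RHS]mul1e -[X in X%:E](@invr1 R).
rewrite -(integral_affine 1 e)//.
by apply: eq_integral => x _; rewrite mul1r.
Qed.

End affine_change_of_variable.

(** * Iterated Lebesgue integrals *)

Section iterated_integral.
Context {R : realType}.
Local Notation mu := (@lebesgue_measure R).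

(* There is no product sigma-algebra on ['I_n -> R] here: measurability in the
   coordinates (and a parameter) is stated by composing with arbitrary
   measurable families of coordinates, which makes it stable under [vcons]. *)
Definition pmeasurable {n d d'} {T : measurableType d} {S : measurableType d'}
    (F : T -> ('I_n -> R) -> S) : Prop :=
  forall d'' (U : measurableType d'') (g : U -> T) (c : 'I_n -> U -> R),
    measurable_fun [set: U] g -> (forall i, measurable_fun [set: U] (c i)) ->
    measurable_fun [set: U] (fun u => F (g u) (fun i => c i u)).

Definition cmeasurable {n d} {S : measurableType d} (f : ('I_n -> R) -> S) : Prop :=
  forall d'' (U : measurableType d'') (c : 'I_n -> U -> R),
    (forall i, measurable_fun [set: U] (c i)) ->
    measurable_fun [set: U] (fun u => f (fun i => c i u)).

Lemma pmeasurable_c {n d} {T : measurableType d} (F : T -> ('I_n -> R) -> \bar R) t :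
  pmeasurable F -> cmeasurable (F t).
Proof. by move=> pF d'' U c mc; exact: (pF _ _ (cst t)). Qed.

Lemma measurable_vcons {n d} {U : measurableType d} (a : U -> R)
    (c : 'I_n -> U -> R) i : measurable_fun [set: U] a ->
  (forall j, measurable_fun [set: U] (c j)) ->
  measurable_fun [set: U] (fun u => vcons (a u) (fun j => c j u) i).
Proof. by move=> ma mc; rewrite /vcons; case: unliftP. Qed.

Lemma vcons0 {n} a (v : 'I_n -> R) : vcons a v ord0 = a.
Proof. by rewrite /vcons unlift_none. Qed.

Lemma vconsS {n} a (v : 'I_n -> R) j : vcons a v (lift ord0 j) = v j.
Proof. by rewrite /vcons liftK. Qed.

(** The binary form of [f] covers translations ([f] is addition) and dilations ([f] ignores a dummy
    second vector) at once. *)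
Lemma vcons_map2 {n} (f : R -> R -> R) a (v : 'I_n -> R) (e : 'I_n.+1 -> R) :
  (fun i => f (vcons a v i) (e i)) =
  vcons (f a (e ord0)) (fun j => f (v j) (e (lift ord0 j))).
Proof.
apply/funext => i; case: (unliftP ord0 i) => [j ->|->]; by rewrite ?vconsS ?vcons0.
Qed.

Lemma lebint_ge0 {n} (f : ('I_n -> R) -> \bar R) :
  (forall x, 0 <= f x)%E -> (0 <= lebint f)%E.
Proof.
elim: n f => [|n IH] f f0 //=.
by apply: integral_ge0 => a _; apply: IH.
Qed.

(** The induction moves the first coordinate into the parameter space, replacing [T] by [T * R], and
    then integrates it out by the one-dimensional Tonelli theorem; hence the arbitrary parameter
    type. *)
Lemma measurable_lebint {n d} {T : measurableType d}
    (F : T -> ('I_n -> R) -> \bar R) :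
  (forall t x, 0 <= F t x)%E -> pmeasurable F ->
  measurable_fun [set: T] (fun t => lebint (F t)).
Proof.
elim: n d T F => [|n IH] d T F F0 pF /=.
  by apply: (pF _ _ id (fun _ _ => 0)).
pose G (ta : T * R) v := F ta.1 (vcons ta.2 v).
have mG : measurable_fun [set: T * R] (fun ta => lebint (G ta)).
  apply: IH => [ta v|d'' U g c mg mc]; first exact: F0.
  apply: pF => [|i]; first exact: measurableT_comp.
  by apply: measurable_vcons => //; exact: measurableT_comp.
have := measurable_fun_fubini_tonelli_F (m2 := mu) (fun ta => lebint (G ta)) mG.
by apply=> ta; apply: lebint_ge0 => x; exact: F0.
Qed.

Lemma cmeasurable_vcons {n} (f : ('I_n.+1 -> R) -> \bar R) :
  cmeasurable f -> pmeasurable (fun a v => f (vcons a v)).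
Proof. by move=> mf d U g c mg mc; apply: mf => i; exact: measurable_vcons. Qed.

Lemma measurable_lebint_vcons {n} (f : ('I_n.+1 -> R) -> \bar R) :
  (forall x, 0 <= f x)%E -> cmeasurable f ->
  measurable_fun [set: R] (fun a => lebint (fun v => f (vcons a v))).
Proof.
move=> f0 mf; apply: (measurable_lebint (fun a v => f (vcons a v))) => //.
exact: cmeasurable_vcons.
Qed.

Lemma lebintZl {n} (k : \bar R) (f : ('I_n -> R) -> \bar R) :
  (0 <= k)%E -> (forall x, 0 <= f x)%E -> cmeasurable f ->
  lebint (fun x => k * f x)%E = (k * lebint f)%E.
Proof.
move=> k0; elim: n f => [|n IH] f f0 mf //=.
rewrite -ge0_integralZl//.
- apply: eq_integral => a _; apply: IH => //.
  exact/(pmeasurable_c (fun a v => f (vcons a v)))/cmeasurable_vcons.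
- exact: measurable_lebint_vcons.
- by move=> a _; exact: lebint_ge0.
Qed.

Lemma lebint_tonelli {n} (F : R -> ('I_n -> R) -> \bar R) :
  (forall t x, 0 <= F t x)%E -> pmeasurable F ->
  lebint (fun x => \int[mu]_s F s x)%E = (\int[mu]_s lebint (F s))%E.
Proof.
elim: n F => [|n IH] F F0 pF //=.
under eq_integral => a _.
  rewrite (IH (fun s v => F s (vcons a v)))//; last first.
    move=> d U g c mg mc; apply: pF => // i.
    by apply: measurable_vcons.
  over.
pose G (z : R * R) v := F z.2 (vcons z.1 v).
apply: (fubini_tonelli (m1 := mu) (m2 := mu) (fun z => lebint (G z))).
  apply: measurable_lebint => [z v|d'' U g c mg mc]; first exact: F0.
  apply: pF => [|i]; first exact: measurableT_comp.
  by apply: measurable_vcons => //; exact: measurableT_comp.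
by move=> z; apply: lebint_ge0 => v; exact: F0.
Qed.

Lemma lebint_translation {n} (e : 'I_n -> R) (f : ('I_n -> R) -> \bar R) :
  (forall x, 0 <= f x)%E -> cmeasurable f ->
  lebint (fun x => f (fun i => x i + e i)) = lebint f.
Proof.
elim: n e f => [|n IH] e f f0 mf /=.
  by congr f; apply/funext; case.
rewrite -(integral_translation (e ord0) (fun a => lebint (fun v => f (vcons a v)))).
- apply: eq_integral => a _.
  under eq_fun do rewrite (vcons_map2 +%R).
  apply: (IH (fun j => e (lift ord0 j)) (fun v => f (vcons (a + e ord0) v))) => //.
  exact/(pmeasurable_c (fun a v => f (vcons a v)))/cmeasurable_vcons.
- exact: measurable_lebint_vcons.
- by move=> a; exact: lebint_ge0.
Qed.

Lemma lebint_scale {n} (k : R) (f : ('I_n -> R) -> \bar R) : 0 < k ->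
  (forall x, 0 <= f x)%E -> cmeasurable f ->
  lebint (fun x => f (scalev k x)) = ((k ^- n)%:E * lebint f)%E.
Proof.
move=> k0; elim: n f => [|n IH] f f0 mf /=.
  by rewrite invr1 mul1e; congr f; apply/funext; case.
have mg := measurable_lebint_vcons f f0 mf.
have g0 a : (0 <= lebint (fun v => f (vcons a v)))%E by exact: lebint_ge0.
transitivity (\int[mu]_a ((k ^- n)%:E * lebint (fun v => f (vcons (k * a + 0) v))))%E.
  apply: eq_integral => a _; rewrite -IH//; last first.
    exact/(pmeasurable_c (fun a v => f (vcons a v)))/cmeasurable_vcons.
  congr lebint; apply/funext => v; congr f.
  rewrite /scalev (vcons_map2 (fun x _ => k * x) a v (fun=> 0)).
  by rewrite addr0.
rewrite ge0_integralZl//; last first.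
- by rewrite lee_fin invr_ge0 exprn_ge0 ?ltW.
- by apply: (measurableT_comp mg); exact: measurable_affine.
rewrite (integral_affine k 0 _ k0 mg)// muleA -EFinM.
by rewrite exprS invfM mulrC.
Qed.

End iterated_integral.

(** * Quadratic forms *)

Section quadratic.
Context {R : realType}.
Local Notation mu := (@lebesgue_measure R).

(** The outermost integral ignores the point 0, so the hyperplane [x ord0 = 0] is negligible. It
    contains the origin, the point where inverses of norms take their default value 0. *)
Lemma lebint_eq_punctured {n} (f g : ('I_n.+1 -> R) -> \bar R) :
  (forall x, 0 <= f x)%E -> (forall x, 0 <= g x)%E ->
  cmeasurable f -> cmeasurable g ->
  (forall x, x ord0 != 0 -> f x = g x) -> lebint f = lebint g.
Proof.
move=> f0 g0 mf mg fg /=.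
have set1_0 : mu [set (0 : R)] = 0%E by exact: lebesgue_measure_set1.
rewrite (ge0_negligible_integral _ _ _ _ set1_0)//; last 2 first.
- exact: measurable_lebint_vcons.
- by move=> a _; exact: lebint_ge0.
rewrite [RHS](ge0_negligible_integral _ _ _ _ set1_0)//; last 2 first.
- exact: measurable_lebint_vcons.
- by move=> a _; exact: lebint_ge0.
apply: eq_integral => a; rewrite inE/= => -[_ /eqP a0].
by congr lebint; apply/funext => v; apply: fg; rewrite vcons0.
Qed.

Lemma dotp_vcons {n} a c (v w : 'I_n -> R) :
  dotp (vcons a v) (vcons c w) = a * c + dotp v w.
Proof.
rewrite /dotp big_ord_recl !vcons0; congr (_ + _).
by apply: eq_bigr => i _; rewrite !vconsS.
Qed.

Lemma vcons_eta {n} (b : 'I_n.+1 -> R) :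
  b = vcons (b ord0) (fun j => b (lift ord0 j)).
Proof.
by apply/funext => i; case: (unliftP ord0 i) => [j ->|->]; rewrite ?vconsS ?vcons0.
Qed.

Lemma measurable_dotp {n d} {U : measurableType d} (c e : 'I_n -> U -> R) :
  (forall i, measurable_fun [set: U] (c i)) ->
  (forall i, measurable_fun [set: U] (e i)) ->
  measurable_fun [set: U] (fun u => dotp (fun i => c i u) (fun i => e i u)).
Proof. by move=> mc me; apply: measurable_sum => i; apply: measurable_funM. Qed.

Lemma dotp_ge0 {n} (x : 'I_n -> R) : 0 <= dotp x x.
Proof. by apply: sumr_ge0 => i _; rewrite -expr2 sqr_ge0. Qed.

Lemma dotpC {n} (x y : 'I_n -> R) : dotp x y = dotp y x.
Proof. by apply: eq_bigr => i _; rewrite mulrC. Qed.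

Lemma dotpDr {n} (x y z : 'I_n -> R) :
  dotp x (fun i => y i + z i) = dotp x y + dotp x z.
Proof. by rewrite /dotp -big_split; apply: eq_bigr => i _; rewrite mulrDr. Qed.

Lemma dotpZr {n} (x y : 'I_n -> R) k : dotp x (fun i => k * y i) = k * dotp x y.
Proof. by rewrite /dotp mulr_sumr; apply: eq_bigr => i _; rewrite mulrCA. Qed.

Lemma dotpDl {n} (x y z : 'I_n -> R) :
  dotp (fun i => y i + z i) x = dotp y x + dotp z x.
Proof. by rewrite dotpC dotpDr !(dotpC x). Qed.

Lemma dotpZl {n} (x y : 'I_n -> R) k : dotp (fun i => k * y i) x = k * dotp y x.
Proof. by rewrite dotpC dotpZr (dotpC x). Qed.

(* Induction on [n]: completing the square in the inner variables leaves a form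
   of the same kind, with [al] and the tail of [b], plus [la * a ^+ 2]. *)
Lemma lebint_quadratic_form {n} (al : R) (b : 'I_n -> R) (phi : R -> \bar R) :
  measurable_fun [set: R] phi -> (forall x, 0 <= phi x)%E -> 0 < al -> dotp b b < al ->
  lebint (fun x : 'I_n -> R => phi (al * dotp x x - dotp b x ^+ 2)) =
  ((Num.sqrt al / (Num.sqrt al ^+ n * Num.sqrt (al - dotp b b)))%:E *
   lebint (fun x : 'I_n -> R => phi (dotp x x)))%E.
Proof.
elim: n b phi => [|n IH] b phi mphi phi0 al0 bal.
  rewrite /= /dotp !big_ord0 expr0n subr0 mul1r !mulr0 subr0.
  by rewrite divff ?mul1e// gt_eqF ?sqrtr_gt0.
rewrite (vcons_eta b) in bal *.
move: (b ord0) (fun j => b (lift ord0 j)) bal => b0 {}b bal.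
rewrite dotp_vcons in bal *.
set B := dotp b b in bal *.
have B0 : 0 <= B by exact: dotp_ge0.
have B1 : 0 < al - B by nra.
have B2 : 0 < al - (b0 * b0 + B) by lra.
(* What remains of the coefficient of [a ^+ 2] once the inner variable sits at its critical point:
   the determinant of the full form divided by that of the inner form. *)
pose la := al * (al - (b0 * b0 + B)) / (al - B).
have la0 : 0 < la by rewrite divr_gt0// mulr_gt0.
pose g a := lebint (fun v : 'I_n -> R => phi (a ^+ 2 + dotp v v)).
have mg : measurable_fun [set: R] g.
  apply: (measurable_lebint (fun (a : R) (v : 'I_n -> R) => phi (a ^+ 2 + dotp v v))) => //.
  move=> d U h c mh mc; apply: (measurableT_comp mphi).
  by apply: measurable_funD; [exact: measurable_funX|exact: measurable_dotp].
have g0 a : (0 <= g a)%E by exact: lebint_ge0.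
(* The inverse square root of the inner determinant [al ^ (n - 1) * (al - B)]; the factor
   [Num.sqrt al] in the numerator avoids the exponent [n - 1], which would truncate at [n = 0]. *)
set K := Num.sqrt al / (Num.sqrt al ^+ n * Num.sqrt (al - B)).
have K0 : 0 <= K by rewrite divr_ge0// mulr_ge0// exprn_ge0.
transitivity (\int[mu]_a (K%:E * g (Num.sqrt la * a + 0)%R))%E.
  rewrite /=; apply: eq_integral => a _.
  (* Along [b] the inner form has eigenvalue [al - B], so the cross term [- 2 a b0 (b.v)] places the
     critical point at [v = s b]. *)
  pose s := a * b0 / (al - B).
  transitivity (lebint (fun v : 'I_n -> R =>
      phi (la * a ^+ 2 + (al * dotp v v - dotp b v ^+ 2)))).
    rewrite -(lebint_translation (fun i => - s * b i)
      (fun v => phi (la * a ^+ 2 + (al * dotp v v - dotp b v ^+ 2))))//.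
      congr lebint; apply/funext => v; congr phi.
      rewrite !dotp_vcons !(dotpDl, dotpDr, dotpZl, dotpZr) -/B (dotpC v b).
      by rewrite /la /s; field; rewrite gt_eqF.
    move=> d U c mc; apply: (measurableT_comp mphi).
    apply: measurable_funD => //; apply: measurable_funB.
      by apply: measurable_funM => //; exact: measurable_dotp.
    by apply: measurable_funX; exact: measurable_dotp.
  (* The term in [a] is absorbed into [phi], which is why [phi] is arbitrary in the induction. *)
  rewrite (IH b (fun y => phi (la * a ^+ 2 + y)))//; last 2 first.
  - by apply: (measurableT_comp mphi); exact: measurable_funD.
  - by rewrite -subr_gt0; exact: B1.
  by rewrite /g addr0 exprMn sqr_sqrtr ?ltW.
rewrite ge0_integralZl//; last first.
  by apply: (measurableT_comp mg); exact: measurable_affine.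
rewrite (integral_affine _ 0 _ _ mg) ?sqrtr_gt0// muleA -EFinM.
congr (_%:E * _)%E.
  rewrite /K /la sqrtrM ?mulr_ge0 ?ltW// sqrtrM ?ltW// sqrtrV ?ltW//.
  rewrite exprS; field.
  by rewrite ?gt_eqF ?sqrtr_gt0 ?exprn_gt0 ?sqrtr_gt0.
apply: eq_integral => a _.
by congr lebint; apply/funext => v; rewrite dotp_vcons expr2.
Qed.

End quadratic.

(** * The dilation-invariant integral *)

Section haar.
Context {R : realType}.
Local Notation mu := (@lebesgue_measure R).

(** Written as [x * |x|^-2], the inverse reduces to a real power; the factor [x] gives the right
    value 0 at 0. *)
Lemma measurable_invr : measurable_fun [set: R] (@GRing.inv R).
Proof.
rewrite (_ : GRing.inv = (fun x : R => x * (`|x| `^ (-1)) ^+ 2)).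
  apply: measurable_funM => //; apply: measurable_funX.
  exact: (measurableT_comp (measurable_powR (-1 : R)) (@normr_measurable R setT)).
apply/funext => x; have [->|x0] := eqVneq x 0; first by rewrite invr0 mul0r.
by rewrite powR_inv1// exprVn real_normK ?num_real//; field.
Qed.

Lemma measurable_funV {d} {T : measurableType d} (f : T -> R) :
  measurable_fun [set: T] f -> measurable_fun [set: T] (fun x => (f x)^-1).
Proof. exact: measurableT_comp measurable_invr. Qed.

Lemma integral_scale (k : R) (f : R -> \bar R) : 0 < k ->
  measurable_fun [set: R] f -> (forall x, 0 <= f x)%E ->
  (\int[mu]_x f (k * x)%R = (k^-1)%:E * \int[mu]_x f x)%E.
Proof.
move=> k0 mf f0; rewrite -(integral_affine k 0)//.
by apply: eq_integral => x _; rewrite addr0.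
Qed.

(* The integral over [s > 0] against [ds/s], which is invariant under dilations. *)
Definition haar_integral (chi : R -> R) : \bar R :=
  (\int[mu]_s (if 0 < s then chi s / s else 0)%:E)%E.

Lemma measurable_haar (chi : R -> R) : measurable_fun [set: R] chi ->
  measurable_fun [set: R] (fun s => (if 0 < s then chi s / s else 0)%:E).
Proof.
move=> mchi; apply/measurable_EFinP; apply: measurable_fun_ifT => //.
  exact: measurable_fun_ltr.
by apply: measurable_funM => //; exact: measurable_invr.
Qed.

Lemma haar_ge0 (chi : R -> R) s : (forall s, 0 <= chi s) ->
  (0 <= (if 0 < s then chi s / s else 0)%:E)%E.
Proof. by move=> chi0; rewrite lee_fin; case: ifPn => // s0; rewrite divr_ge0// ltW. Qed.

Lemma haar_integral_scale (k : R) (chi : R -> R) : 0 < k ->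
  measurable_fun [set: R] chi -> (forall s, 0 <= chi s) ->
  haar_integral (fun s => chi (k * s)) = haar_integral chi.
Proof.
move=> k0 mchi chi0.
pose g s := (if 0 < s then chi s / s else 0)%:E.
have mg : measurable_fun [set: R] g by exact: measurable_haar.
have g0 s : (0 <= g s)%E by exact: haar_ge0.
transitivity (\int[mu]_s (k%:E * g (k * s)%R))%E.
  apply: eq_integral => s _; rewrite /g pmulr_rgt0//; case: ifPn => s0.
    by rewrite -EFinM; congr EFin; field; rewrite !gt_eqF.
  by rewrite mule0.
rewrite ge0_integralZl//; last 2 first.
- by apply: (measurableT_comp mg).
- by rewrite lee_fin ltW.
by rewrite integral_scale// muleA -EFinM divff ?mul1e// gt_eqF.
Qed.

Lemma haar_integralZl (k : R) (chi : R -> R) : 0 <= k ->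
  measurable_fun [set: R] chi -> (forall s, 0 <= chi s) ->
  haar_integral (fun s => k * chi s) = (k%:E * haar_integral chi)%E.
Proof.
move=> k0 mchi chi0; rewrite -ge0_integralZl//; last 2 first.
- exact: measurable_haar.
- by move=> s _; exact: haar_ge0.
apply: eq_integral => s _; case: ifP => _; last by rewrite mule0.
by rewrite -EFinM mulrA.
Qed.

(* Integrate [H x * chi1 (N1 x) * chi2 (s * N2 x)] against [dx ds/s] in both
   orders, replacing [x] by [x / sqrt s] when [x] is integrated first: the
   integral of [H * chi (N)] depends on [N] only through a factor common to all
   [chi]. *)
Lemma haar_exchange {n} (H N1 N2 : ('I_n -> R) -> R) (chi1 chi2 : R -> R) :
  cmeasurable H -> cmeasurable N1 -> cmeasurable N2 ->
  measurable_fun [set: R] chi1 -> measurable_fun [set: R] chi2 ->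
  (forall x, 0 <= H x) -> (forall x, 0 <= N1 x) -> (forall x, 0 <= N2 x) ->
  (forall s, 0 <= chi1 s) -> (forall s, 0 <= chi2 s) ->
  chi1 0 = 0 -> chi2 0 = 0 -> (forall x, (N1 x == 0) = (N2 x == 0)) ->
  (forall r x, 0 < r -> H (scalev r x) = r ^- n * H x) ->
  (forall r x, 0 < r -> N1 (scalev r x) = r ^+ 2 * N1 x) ->
  (forall r x, 0 < r -> N2 (scalev r x) = r ^+ 2 * N2 x) ->
  (haar_integral chi2 * lebint (fun x => (H x * chi1 (N1 x))%:E) =
   haar_integral (fun s => chi1 s^-1%R) * lebint (fun x => (H x * chi2 (N2 x))%:E))%E.
Proof.
move=> mH mN1 mN2 mc1 mc2 H0 N10 N20 c10 c20 c1z c2z N12 hH hN1 hN2.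
have mc1V : measurable_fun [set: R] (fun s => chi1 s^-1).
  exact: (measurableT_comp mc1 measurable_invr).
rewrite -lebintZl//; last 3 first.
- by apply: integral_ge0 => s _; exact: haar_ge0.
- by move=> x; rewrite lee_fin mulr_ge0.
- move=> d U c mc; apply/measurable_EFinP; apply: measurable_funM; first exact: mH.
  by apply: (measurableT_comp mc1); exact: mN1.
rewrite -[in RHS]lebintZl//; last 3 first.
- by apply: integral_ge0 => s _; exact: (haar_ge0 (fun s => chi1 s^-1)).
- by move=> x; rewrite lee_fin mulr_ge0.
- move=> d U c mc; apply/measurable_EFinP; apply: measurable_funM; first exact: mH.
  by apply: (measurableT_comp mc2); exact: mN2.
(* Integrated in [s] first, [P] yields the left integrand and [Q] the right one; for fixed [s > 0] a
   dilation of [x] turns [Q] into [P]. *)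
pose P s x := (if 0 < s then H x * chi1 (N1 x) * chi2 (N2 x * s) / s else 0)%:E.
pose Q s x := (if 0 < s then H x * chi2 (N2 x) * chi1 (N1 x / s) / s else 0)%:E.
have P0 s x : (0 <= P s x)%E.
  by rewrite lee_fin; case: ifPn => // s0; rewrite divr_ge0 ?mulr_ge0// ltW.
have Q0 s x : (0 <= Q s x)%E.
  by rewrite lee_fin; case: ifPn => // s0; rewrite divr_ge0 ?mulr_ge0// ltW.
have mP : pmeasurable P.
  move=> d U g c mg mc; apply/measurable_EFinP; apply: measurable_fun_ifT => //.
    exact: measurable_fun_ltr.
  apply: measurable_funM; last exact: measurable_funV.
  apply: measurable_funM.
    apply: measurable_funM; first exact: mH.
    by apply: (measurableT_comp mc1); exact: mN1.
  by apply: (measurableT_comp mc2); apply: measurable_funM => //; exact: mN2.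
have mQ : pmeasurable Q.
  move=> d U g c mg mc; apply/measurable_EFinP; apply: measurable_fun_ifT => //.
    exact: measurable_fun_ltr.
  apply: measurable_funM; last exact: measurable_funV.
  apply: measurable_funM.
    apply: measurable_funM; first exact: mH.
    by apply: (measurableT_comp mc2); exact: mN2.
  apply: (measurableT_comp mc1); apply: measurable_funM; first exact: mN1.
  exact: measurable_funV.
transitivity (lebint (fun x => \int[mu]_s P s x)%E).
  congr lebint; apply/funext => x.
  (* Where [N1 x] vanishes, both sides are 0 since [chi1 0 = 0]. Elsewhere [N2 x > 0] as well, so
     that [s] may be rescaled by [N2 x]. *)
  have [N1x|N1x] := eqVneq (N1 x) 0.
    rewrite N1x c1z mulr0 mule0 integral0_eq// => s _.
    by rewrite /P N1x c1z mulr0 !mul0r if_same.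
  rewrite muleC -(haar_integral_scale (N2 x))//; last first.
    by rewrite lt_neqAle N20 eq_sym -N12 N1x.
  rewrite -haar_integralZl ?mulr_ge0//.
  by apply: (measurableT_comp mc2).
transitivity (lebint (fun x => \int[mu]_s Q s x)%E); last first.
  congr lebint; apply/funext => x.
  have [N2x|N2x] := eqVneq (N2 x) 0.
    rewrite N2x c2z mulr0 mule0 integral0_eq// => s _.
    by rewrite /Q N2x c2z mulr0 !mul0r if_same.
  have N1x : 0 < N1 x by rewrite lt_neqAle N10 eq_sym N12 N2x.
  rewrite [RHS]muleC -(haar_integral_scale (N1 x)^-1) ?invr_gt0//.
  rewrite -haar_integralZl ?mulr_ge0//; last first.
    by apply: (measurableT_comp mc1V).
  by apply: eq_integral => s _; rewrite /Q invfM invrK.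
rewrite !lebint_tonelli//; apply: eq_integral => s _.
case: (ltP 0 s) => s0; last first.
  by congr lebint; apply/funext => x; rewrite /P /Q ltNge s0.
have r0 : 0 < Num.sqrt s by rewrite sqrtr_gt0.
have rn0 : 0 < Num.sqrt s ^+ n by exact: exprn_gt0.
(* The inserted factor [sqrt s ^ n] over itself supplies the Jacobian of the dilation by [sqrt s];
   the other half is cancelled by the degree [-n] of [H]. *)
rewrite -[RHS]mul1e -(divff (lt0r_neq0 rn0)) EFinM -muleA -lebint_scale//; last first.
  exact: pmeasurable_c.
rewrite -lebintZl ?lee_fin ?exprn_ge0//.
  congr lebint; apply/funext => x; rewrite /P /Q s0 -EFinM; congr EFin.
  rewrite hH// hN1// hN2// sqr_sqrtr ?ltW//.
  rewrite (mulrC s (N1 x)) mulfK ?gt_eqF// (mulrC s (N2 x)).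
  by field; rewrite ?gt_eqF.
move=> d U c mc; apply: mQ => // i.
by apply: measurable_funM.
Qed.

End haar.

(** * Balls *)

Section ball.
Context {R : realType}.
Local Notation mu := (@lebesgue_measure R).

Lemma powR_cvgy (q : R) : 0 < q -> s `^ q @[s --> +oo%R] --> +oo%R.
Proof.
move=> q0; apply/cvgryPge => A; near=> s.
have A0 : 0 <= `|A| `^ q^-1 by exact: powR_ge0.
have As : `|A| `^ q^-1 <= s by near: s; apply: nbhs_pinfty_ge; exact: num_real.
apply: (le_trans (ler_norm A)).
rewrite -[leLHS]powRr1// -(mulVf (lt0r_neq0 q0)) powRrM.
by apply: ge0_ler_powR; rewrite ?nnegrE ?(ltW q0)// (le_trans A0).
Unshelve. all: by end_near. Qed.

Lemma powRN_cvg0 (q : R) : 0 < q -> s `^ (- q) @[s --> +oo%R] --> (0 : R).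
Proof.
move=> q0; under eq_fun do rewrite powRN.
apply/gtr0_cvgV0; last exact: powR_cvgy.
near=> s; apply: powR_gt0.
by near: s; apply: nbhs_pinfty_gt; exact: num_real.
Unshelve. all: by end_near. Qed.

Lemma integral_powRN (q : R) : 0 < q ->
  (\int[mu]_(s in `[1%R, +oo[) (s `^ (- q - 1))%:E = (q^-1)%:E)%E.
Proof.
move=> q0.
have dF (x : R) : 0 < x ->
    is_derive x 1 (fun s : R => - q^-1 * s `^ (- q)) (x `^ (- q - 1)).
  move=> x0; have -> : x `^ (- q - 1) = - q^-1 *: (- q * x `^ (- q - 1)).
    by rewrite /GRing.scale/= mulrA mulrNN mulVf ?mul1r// gt_eqF.
  by apply: is_deriveZ; exact: is_derive1_powR.
have cF (r x : R) : 0 < x -> {for x, continuous (fun s : R => s `^ r)}.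
  move=> x0; apply: differentiable_continuous; apply/derivable1_diffP.
  by apply: ex_derive; exact: is_derive1_powR.
rewrite (@ge0_continuous_FTC2y _ _ (fun s : R => - q^-1 * s `^ (- q)) _ 0).
- by rewrite powR1 mulr1 sub0e EFinN oppeK.
- by move=> x _; exact: powR_ge0.
- apply/continuous_within_itvcyP; split.
    by move=> x; rewrite in_itv/= andbT => x1; apply: cF; rewrite (lt_trans _ x1).
  by apply: cvg_at_right_filter; apply: cF.
- rewrite -[X in _ --> X](mulr0 (- q^-1)).
  by apply: cvgMr; exact: powRN_cvg0.
- move=> x x1; apply: ex_derive; apply: dF.
  by rewrite (lt_trans _ x1).
- apply: cvg_at_right_filter; apply: cvgMr; exact: (cF _ 1).
- move=> x; rewrite in_itv/= andbT => x1; rewrite derive1E.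
  by apply: derive_val; apply: dF; rewrite (lt_trans _ x1).
Qed.

Lemma lebint_gauss n :
  lebint (fun x : 'I_n -> R => (expR (- dotp x x))%:E) = (Num.sqrt pi ^+ n)%:E.
Proof.
elim: n => [|n IH] /=; first by rewrite /dotp big_ord0 oppr0 expR0.
transitivity (\int[mu]_a ((Num.sqrt pi ^+ n)%:E * (gauss_fun a)%:E))%E.
  apply: eq_integral => a _; rewrite -IH muleC -lebintZl//.
  - congr lebint; apply/funext => v.
    by rewrite dotp_vcons opprD expRD EFinM /gauss_fun expr2.
  - by rewrite lee_fin gauss_fun_ge0.
  - move=> d U c mc; apply/measurable_EFinP; apply: measurableT_comp => //.
    by apply: measurableT_comp => //; exact: measurable_dotp.
rewrite ge0_integralZl//.
- by rewrite integralT_gauss -EFinM exprSr.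
- by apply/measurable_EFinP; exact: measurable_gauss_fun.
- by move=> a _; rewrite lee_fin gauss_fun_ge0.
Qed.

Lemma enorm_ge0 {n} (x : 'I_n -> R) : 0 <= enorm x. Proof. exact: sqrtr_ge0. Qed.

Lemma sqr_enorm {n} (x : 'I_n -> R) : enorm x ^+ 2 = dotp x x.
Proof. by rewrite sqr_sqrtr// dotp_ge0. Qed.

Lemma dotp_scalev {n} r (x : 'I_n -> R) : dotp (scalev r x) (scalev r x) = r ^+ 2 * dotp x x.
Proof. by rewrite dotpZl dotpZr mulrA expr2. Qed.

Lemma enorm_scalev {n} r (x : 'I_n -> R) : 0 <= r -> enorm (scalev r x) = r * enorm x.
Proof.
by move=> r0; rewrite /enorm dotp_scalev sqrtrM ?sqr_ge0// sqrtr_sqr ger0_norm.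
Qed.

Lemma enorm_eq0 {n} (x : 'I_n -> R) : (enorm x == 0) = (dotp x x == 0).
Proof. by rewrite -sqr_enorm sqrf_eq0. Qed.

Lemma dotp_eq0 {n} (x : 'I_n -> R) i : dotp x x = 0 -> x i = 0.
Proof.
move=> /eqP; rewrite psumr_eq0; last by move=> j _; rewrite -expr2 sqr_ge0.
by move=> /allP/(_ i (mem_index_enum i))/=; rewrite -expr2 sqrf_eq0 => /eqP.
Qed.

Lemma enorm_gt0 {n} (x : 'I_n.+1 -> R) : x ord0 != 0 -> 0 < enorm x.
Proof.
move=> x0; rewrite lt_neqAle enorm_ge0 andbT eq_sym enorm_eq0.
by apply: contra x0 => /eqP/dotp_eq0 ->.
Qed.

Lemma measurable_sqrt : measurable_fun [set: R] (@Num.sqrt R).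
Proof. by apply: continuous_measurable_fun; exact: sqrt_continuous. Qed.

Lemma measurable_enorm {n} : cmeasurable (@enorm R n).
Proof.
move=> d U c mc; apply: (measurableT_comp measurable_sqrt).
exact: measurable_dotp.
Qed.

Lemma measurable_dotpxx {n} : cmeasurable (fun x : 'I_n -> R => dotp x x).
Proof. by move=> d U c mc; exact: measurable_dotp. Qed.

Definition ball_volume n : \bar R :=
  lebint (fun x : 'I_n -> R => (if 0 < enorm x <= 1 then 1 else 0)%:E).

(** The weight [sqrt s ^ n] is chosen so that [|x|^-n * chi_ball n (|x|^2)] is the indicator of the
    punctured unit ball. *)
Definition chi_ball n (s : R) : R := if 0 < s <= 1 then Num.sqrt s ^+ n else 0.

Lemma measurable_chi_ball n : measurable_fun [set: R] (chi_ball n).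
Proof.
apply: measurable_fun_ifT => //.
  by apply: measurable_and; [exact: measurable_fun_ltr|exact: measurable_fun_ler].
by apply: measurable_funX; exact: measurable_sqrt.
Qed.

Lemma chi_ball_ge0 n s : 0 <= chi_ball n s.
Proof. by rewrite /chi_ball; case: ifP => // _; rewrite exprn_ge0. Qed.

Lemma chi_ball0 n : chi_ball n 0 = 0.
Proof. by rewrite /chi_ball ltxx. Qed.

Lemma sqrt_powR (s : R) n : 0 <= s -> Num.sqrt s ^+ n = s `^ (n%:R / 2).
Proof. by move=> s0; rewrite -powR_mulrn// -powR12_sqrt// -powRrM mulrC. Qed.

(** The inversion moves the support to [s >= 1], where the integrand is [s ^ (- n/2 - 1)]. *)
Lemma haar_integral_chi_ball n : (0 < n)%N ->
  haar_integral (fun s => chi_ball n s^-1) = (2 / n%:R)%:E.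
Proof.
move=> n0; have q0 : (0 : R) < n%:R / 2 by rewrite divr_gt0 ?ltr0n.
rewrite -[2 / _]invf_div -(integral_powRN _ q0) [RHS]integral_mkcond.
apply: eq_integral => s _; rewrite patchE /chi_ball.
case: ifPn => s0; last first.
  by rewrite memNset//= in_itv/= andbT => s1; move: s0; rewrite (lt_le_trans _ s1).
rewrite invr_gt0 s0 invf_le1//=; case: (leP 1 s) => s1.
  rewrite mem_set/= ?in_itv/= ?s1//; congr EFin.
  rewrite powRD ?(gt_eqF s0) ?implybT// !powRN powRr1 ?ltW//; congr (_ / _).
  by rewrite -sqrt_powR ?ltW// sqrtrV ?ltW// exprVn.
by rewrite mul0r memNset//= in_itv/= andbT leNgt s1.
Qed.

End ball.

(** * Volume of the unit ball and the surface constant *)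

Section surface.
Context {R : realType}.
Local Notation mu := (@lebesgue_measure R).

(** The exchange formula gives only the product of a Gamma integral and a ball volume. Since
    [0 * +oo = 0], a positive finite product of nonnegative factors makes both factors positive and
    finite. *)
Lemma mule_eq_fin_gt0 (x y : \bar R) (r : R) : (0 <= x)%E -> (0 <= y)%E ->
  (x * y = r%:E)%E -> 0 < r ->
  exists a b : R, [/\ 0 < a, 0 < b, x = a%:E & y = b%:E].
Proof.
move=> x0 y0 xy r0.
have xz : (x != 0)%E.
  by apply/eqP => xz; move: xy r0; rewrite xz mul0e => -[<-]; rewrite ltxx.
have yz : (y != 0)%E.
  by apply/eqP => yz; move: xy r0; rewrite yz mule0 => -[<-]; rewrite ltxx.
have xp : (0 < x)%E by rewrite lt_neqAle eq_sym xz.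
have yp : (0 < y)%E by rewrite lt_neqAle eq_sym yz.
case: x y xy xp yp {x0 y0 xz yz} => [a| |] [b| |]//=.
- by move=> _ a0 b0; exists a, b.
- by rewrite lte_fin => + a0 _; rewrite gt0_muley.
- by rewrite lte_fin => + _ b0; rewrite gt0_mulye.
Qed.

Lemma enorm_ball {n} (x : 'I_n -> R) : (0 < dotp x x <= 1) = (0 < enorm x <= 1).
Proof.
rewrite -sqr_enorm -[X in _ <= X](expr1n R 2) ler_pXn2r ?nnegrE ?enorm_ge0//.
by rewrite !lt_neqAle sqr_ge0 enorm_ge0 !andbT !(eq_sym 0) sqrf_eq0.
Qed.

Lemma measurable_indicator_ball {n} :
  cmeasurable (fun x : 'I_n -> R => (if 0 < enorm x <= 1 then 1 else 0 : R)%:E).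
Proof.
move=> d U c mc; apply/measurable_EFinP; apply: measurable_fun_ifT => //.
have me := measurable_enorm d U c mc.
by apply: measurable_and; [exact: measurable_fun_ltr|exact: measurable_fun_ler].
Qed.

Lemma measurable_enormV {n} : cmeasurable (fun x : 'I_n -> R => (enorm x)^-1 ^+ n).
Proof.
move=> d U c mc; apply: measurable_funX; apply: measurable_funV.
exact: measurable_enorm.
Qed.

Lemma lebint_chi_ball n :
  lebint (fun x : 'I_n -> R => ((enorm x)^-1 ^+ n * chi_ball n (dotp x x))%:E) =
  ball_volume n.
Proof.
congr lebint; apply/funext => x; rewrite /chi_ball enorm_ball -/(enorm x).
case: ifPn => [/andP[x0 _]|_]; last by rewrite mulr0.
by rewrite -exprMn mulVf ?gt_eqF// expr1n.
Qed.

(** Polar coordinates for radial functions: the exchange with [H = |x|^-n], both gauges [|x|^2], and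
    [chi_ball] as reference weight. *)
Lemma haar_exchange_ball n (chi : R -> R) : (0 < n)%N ->
  measurable_fun [set: R] chi -> (forall s, 0 <= chi s) -> chi 0 = 0 ->
  (haar_integral chi * ball_volume n = (2 / n%:R)%:E *
   lebint (fun x : 'I_n -> R => ((enorm x)^-1 ^+ n * chi (dotp x x))%R%:E))%E.
Proof.
move=> n0 mchi chi0 chiz; pose H (x : 'I_n -> R) := (enorm x)^-1 ^+ n.
have H0 x : 0 <= H x by rewrite exprn_ge0// invr_ge0 enorm_ge0.
have hH r x : 0 < r -> H (scalev r x) = r ^- n * H x.
  by move=> r0; rewrite /H enorm_scalev ?ltW// invfM exprMn !exprVn.
have hN r (x : 'I_n -> R) : 0 < r ->
  dotp (scalev r x) (scalev r x) = r ^+ 2 * dotp x x by rewrite dotp_scalev.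
rewrite -haar_integral_chi_ball// -(haar_exchange H _ _ _ _ measurable_enormV
  measurable_dotpxx measurable_dotpxx (measurable_chi_ball n) mchi H0 dotp_ge0
  dotp_ge0 (chi_ball_ge0 n) chi0 (chi_ball0 n) chiz (fun=> erefl) hH hN hN).
by rewrite lebint_chi_ball.
Qed.

(** A Gaussian is integrated both radially and coordinatewise, which gives
    [Gamma(n/2) * V = (2/n) * pi^(n/2)] for the ball volume [V]. *)
Lemma ball_volume_Asurf n : (0 < n)%N ->
  0 < @Asurf R n /\ ball_volume n = (@Asurf R n / n%:R)%:E.
Proof.
case: n => // m _; set n := m.+1.
(* Chosen so that [|x|^-n * chi_g (|x|^2)] is [exp (- |x|^2)] off the origin, while the integral of
   [chi_g] against [ds/s] is the Gamma integral at [n/2]. *)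
pose chi_g (s : R) := if 0 < s then Num.sqrt s ^+ n * expR (- s) else 0.
have mchi_g : measurable_fun [set: R] chi_g.
  apply: measurable_fun_ifT => //.
    exact: measurable_fun_ltr.
  apply: measurable_funM.
    exact: (measurable_funX n measurable_sqrt).
  exact: (measurableT_comp (@measurable_expR R)).
have chi_g0 s : 0 <= chi_g s.
  by rewrite /chi_g; case: ifP => // _; rewrite mulr_ge0 ?exprn_ge0 ?expR_ge0.
have chi_gz : chi_g 0 = 0 by rewrite /chi_g ltxx.
have := haar_exchange_ball n chi_g isT mchi_g chi_g0 chi_gz.
have -> : lebint (fun x : 'I_n -> R =>
    ((enorm x)^-1 ^+ n * chi_g (dotp x x))%:E) = (Num.sqrt pi ^+ n)%:E.
  rewrite -lebint_gauss; apply: lebint_eq_punctured.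
  - by move=> x; rewrite lee_fin mulr_ge0// exprn_ge0// invr_ge0 enorm_ge0.
  - by move=> x; rewrite lee_fin expR_ge0.
  - move=> d U c mc; apply/measurable_EFinP; apply: measurable_funM.
      exact: measurable_enormV.
    by apply: (measurableT_comp mchi_g); exact: measurable_dotp.
  - move=> d U c mc; apply/measurable_EFinP; apply: measurableT_comp => //.
    by apply: measurableT_comp => //; exact: measurable_dotp.
  - move=> x /enorm_gt0 x0; rewrite /chi_g -sqr_enorm exprn_gt0//.
    rewrite sqrtr_sqr ger0_norm ?ltW// mulrA -exprMn mulVf ?gt_eqF//.
    by rewrite expr1n mul1r.
rewrite -EFinM => HE.
have r0 : 0 < 2 / n%:R * Num.sqrt (pi : R) ^+ n.
  by rewrite mulr_gt0 ?divr_gt0 ?ltr0n// exprn_gt0// sqrtr_gt0 pi_gt0.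
have [||G [V [G0 V0 GE VE]]] := mule_eq_fin_gt0 _ _ _ _ _ HE r0.
- by apply: integral_ge0 => s _; exact: haar_ge0.
- by apply: lebint_ge0 => x; rewrite lee_fin; case: ifP.
have Gamma : Gammaf (n%:R / 2) = G.
  rewrite /Gammaf /Rintegral -[RHS]/(fine G%:E) -GE; congr fine.
  rewrite integral_mkcond; apply: eq_integral => s _; rewrite patchE /chi_g.
  case: (ltP 0 s) => s0; last first.
    by rewrite memNset//= in_itv/= andbT ltNge s0.
  rewrite mem_set/= ?in_itv/= ?s0//; congr EFin.
  rewrite powRD ?(gt_eqF s0) ?implybT// powRN powRr1 ?ltW// -sqrt_powR ?ltW//.
  by rewrite mulrAC.
have A : @Asurf R n = n%:R * V.
  have : G * V = 2 / n%:R * Num.sqrt (pi : R) ^+ n.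
    by move: HE; rewrite GE VE => -[].
  rewrite /Asurf Gamma -sqrt_powR ?pi_ge0// => GV.
  apply: (mulfI (lt0r_neq0 G0)); rewrite [RHS]mulrCA GV.
  by field; rewrite !gt_eqF ?ltr0n.
rewrite A; split; first by rewrite mulr_gt0// ltr0n.
by rewrite VE mulrC mulrA mulVf ?mul1r// gt_eqF// ltr0n.
Qed.

End surface.

(** * Ellipsoids with a focus at the origin *)

Section focal.
Context {R : realType}.
Local Notation mu := (@lebesgue_measure R).

Lemma cauchy_schwarz {n} (b x : 'I_n -> R) :
  dotp b x ^+ 2 <= dotp b b * dotp x x.
Proof.
have [B0|B0] := eqVneq (dotp b b) 0.
  rewrite B0 mul0r /dotp big1 ?expr0n// => i _.
  by rewrite (dotp_eq0 _ i B0) mul0r.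
have Bp : 0 < dotp b b by rewrite lt_neqAle eq_sym B0 dotp_ge0.
(* This vector is [|b|^2] times the component of [x] orthogonal to [b]. *)
have := dotp_ge0 (fun i => dotp b b * x i + - dotp b x * b i).
rewrite !(dotpDl, dotpDr, dotpZl, dotpZr) (dotpC x b).
rewrite (_ : _ + _ = dotp b b * (dotp b b * dotp x x - dotp b x ^+ 2)).
  by rewrite pmulr_rge0// subr_ge0.
by ring.
Qed.

Lemma ler_dotp_enorm {n} (b x : 'I_n -> R) : dotp b x <= enorm b * enorm x.
Proof.
rewrite (le_trans (ler_norm _))// -(@ler_pXn2r _ 2%N) ?nnegrE ?mulr_ge0 ?enorm_ge0//.
by rewrite real_normK ?num_real// exprMn !sqr_enorm cauchy_schwarz.
Qed.

(** The extension of [a - b.x] from the sphere that is homogeneous of degree 1 under positive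
    dilations. *)
Definition focal {n} (a : R) (b x : 'I_n -> R) := a * enorm x - dotp b x.

Section focal_positive.
Variables (n : nat) (a : R) (b : 'I_n -> R).
Hypotheses (a0 : 0 < a) (ba : dotp b b < a ^+ 2).

Lemma enorm_lt : enorm b < a.
Proof.
by rewrite -(@ltr_pXn2r _ 2%N) ?nnegrE ?enorm_ge0 ?ltW// sqr_enorm.
Qed.

Lemma focal_gt0 x : 0 < enorm x -> 0 < focal a b x.
Proof.
move=> x0; rewrite subr_gt0 (le_lt_trans (ler_dotp_enorm b x))//.
by rewrite ltr_pM2r// enorm_lt.
Qed.

Lemma focal_eq0 x : (focal a b x == 0) = (enorm x == 0).
Proof.
have [x0|x0] := eqVneq (enorm x) 0; last first.
  by rewrite gt_eqF// focal_gt0// lt_neqAle eq_sym x0 enorm_ge0.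
rewrite /focal x0 mulr0 sub0r oppr_eq0 -sqrf_eq0 eq_le sqr_ge0 andbT.
by rewrite (le_trans (cauchy_schwarz b x))// -(sqr_enorm x) x0 expr0n mulr0.
Qed.

Lemma focal_ge0 x : 0 <= focal a b x.
Proof.
have [x0|x0] := eqVneq (enorm x) 0.
  by move/eqP : x0; rewrite -focal_eq0 => /eqP ->.
by rewrite ltW// focal_gt0// lt_neqAle eq_sym x0 enorm_ge0.
Qed.

Lemma focal_scalev r x : 0 < r -> focal a b (scalev r x) = r * focal a b x.
Proof. by move=> r0; rewrite /focal enorm_scalev ?ltW// dotpZr; ring. Qed.

Lemma measurable_focal : cmeasurable (focal a b).
Proof.
move=> d U c mc; apply: measurable_funB; last exact: measurable_dotp.
by apply: measurable_funM => //; exact: measurable_enorm.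
Qed.

(* In polar form [focal a b x <= 1] says [r <= 1 / (a - b . xi)]: a conic with
   a focus at the origin. *)
Lemma focal_le1 x : (focal a b x <= 1) =
  (a ^+ 2 * dotp x x - dotp b x ^+ 2 - 2 * dotp b x <= 1).
Proof.
rewrite -sqr_enorm; set X := enorm x; set s := dotp b x.
have X0 : 0 <= X by exact: enorm_ge0.
have B0 := enorm_ge0 b; have Ba := enorm_lt.
have sX : s <= enorm b * X := ler_dotp_enorm b x.
(* Squaring [a X <= 1 + s] would also admit [a X <= - (1 + s)]; this bound, with [|b| < a], rules
   that branch out. *)
have sX' : - s <= enorm b * X.
  have := ler_dotp_enorm b (scalev (-1) x); rewrite dotpZr mulN1r.
  by rewrite /enorm dotp_scalev sqrrN expr1n mul1r.
have -> : (a ^+ 2 * X ^+ 2 - s ^+ 2 - 2 * s <= 1) = ((a * X) ^+ 2 <= (1 + s) ^+ 2).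
  by apply/idP/idP => ?; nra.
have aX0 : 0 <= a * X by rewrite mulr_ge0// ltW.
have bX : enorm b * X <= a * X by rewrite ler_wpM2r// ltW.
rewrite /focal -/X -/s lerBlDr; apply/idP/idP => [h|].
  by rewrite ler_pXn2r// nnegrE// (le_trans aX0).
rewrite -[(1 + s) ^+ 2](@real_normK R) ?num_real// ler_pXn2r// ?nnegrE//.
by case: (ger0P (1 + s)) => // s1 h; exfalso; lra.
Qed.

End focal_positive.

Lemma mulIe_fin (r : R) (x y : \bar R) : r != 0 ->
  (x * r%:E = y * r%:E)%E -> x = y.
Proof.
move=> r0 /(congr1 (fun z => z * r^-1%:E)%E).
by rewrite -!muleA -!EFinM divff// !mule1.
Qed.

(** Follows without a second computation: with [chi_ball] as both weights in the exchange, both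
    sides contain the ball volume, which is finite and nonzero and cancels. *)
Lemma haar_integral_chi_ballE n : (0 < n)%N ->
  haar_integral (@chi_ball R n) = (2 / n%:R)%:E.
Proof.
move=> n0; have [A0 VE] := @ball_volume_Asurf R n n0.
have := haar_exchange_ball n (@chi_ball R n) n0 (measurable_chi_ball n)
  (chi_ball_ge0 n) (chi_ball0 n).
rewrite lebint_chi_ball VE; set V := @Asurf R n / n%:R; have V0 : V != 0.
  by rewrite mulf_neq0 ?invr_eq0 ?pnatr_eq0 -?lt0n// gt_eqF.
exact: (mulIe_fin _ _ _ V0).
Qed.

Lemma lebint_unit_ball n : (0 < n)%N ->
  lebint (fun x : 'I_n -> R => (if dotp x x <= 1 then 1 else 0 : R)%:E) =
  ball_volume n.
Proof.
case: n => // n _; apply: lebint_eq_punctured.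
- by move=> x; rewrite lee_fin; case: ifP.
- by move=> x; rewrite lee_fin; case: ifP.
- move=> d U c mc; apply/measurable_EFinP; apply: measurable_fun_ifT => //.
  by apply: measurable_fun_ler => //; exact: measurable_dotp.
- exact: measurable_indicator_ball.
- move=> x /enorm_gt0 x0; rewrite -enorm_ball.
  by rewrite -sqr_enorm exprn_gt0.
Qed.

(** With [D = sqrt (a^2 - |b|^2)], the quadratic form contributes [a / (a^n D)] and the ball of
    radius [a / D] to which it is reduced contributes [(a / D)^n]; hence the exponent [n + 1]. *)
Lemma lebint_focal_le1 n (a : R) (b : 'I_n -> R) : (0 < n)%N ->
  0 < a -> dotp b b < a ^+ 2 ->
  lebint (fun x => (if focal a b x <= 1 then 1 else 0 : R)%:E) =
  ((a / Num.sqrt (a ^+ 2 - dotp b b) ^+ n.+1)%:E * ball_volume n)%E.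
Proof.
move=> n0 a0 ba; set B := dotp b b in ba *.
have D0 : 0 < a ^+ 2 - B by rewrite subr_gt0.
set D := Num.sqrt (a ^+ 2 - B).
have Dp : 0 < D by rewrite sqrtr_gt0.
have D2 : D ^+ 2 = a ^+ 2 - B by rewrite sqr_sqrtr// ltW.
(* The centre of the ellipsoid is [b / (a^2 - B)]. Moving it to the origin adds [B / (a^2 - B)] to
   the bound 1, which gives this threshold. *)
pose phi (y : R) := (if y <= a ^+ 2 / (a ^+ 2 - B) then 1 else 0 : R)%:E.
have mphi : measurable_fun [set: R] phi.
  apply/measurable_EFinP; apply: measurable_fun_ifT => //.
  exact: measurable_fun_ler.
have phi0 y : (0 <= phi y)%E by rewrite lee_fin; case: ifP.
pose e i := - (a ^+ 2 - B)^-1 * b i.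
transitivity (lebint (fun x => phi (a ^+ 2 * dotp x x - dotp b x ^+ 2))).
  rewrite -(lebint_translation e (fun x => phi (a ^+ 2 * dotp x x - dotp b x ^+ 2)))//.
    congr lebint; apply/funext => x; rewrite focal_le1// /phi; congr (if _ then _ else _)%:E.
    rewrite /e !(dotpDl, dotpDr, dotpZl, dotpZr) (dotpC x b) -/B.
    rewrite -subr_ge0 -[RHS]subr_ge0; congr (0 <= _).
    by field; rewrite gt_eqF.
  move=> d U c mc; apply: (measurableT_comp mphi); apply: measurable_funB.
    by apply: measurable_funM => //; exact: measurable_dotp.
  by apply: measurable_funX; exact: measurable_dotp.
rewrite lebint_quadratic_form// ?exprn_gt0// -/B -/D.
rewrite sqrtr_sqr gtr0_norm//.
have c0 : 0 < a / D by rewrite divr_gt0.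
have cn0 : (a / D) ^+ n != 0 by rewrite expf_neq0// gt_eqF.
have -> : lebint (fun x : 'I_n -> R => phi (dotp x x)) =
    (((a / D) ^+ n)%:E * ball_volume n)%E.
  rewrite -lebint_unit_ball//.
  have -> : (fun x : 'I_n -> R => (if dotp x x <= 1 then 1 else 0 : R)%:E) =
      (fun x => phi (dotp (scalev (a / D) x) (scalev (a / D) x))).
    apply/funext => x; rewrite /phi dotp_scalev; congr (if _ then _ else _)%:E.
    rewrite -D2 -expr_div_n -[X in _ = (_ <= X)]mulr1.
    by rewrite ler_pM2l// exprn_gt0.
  rewrite (lebint_scale _ (fun x => phi (dotp x x)))//.
    by rewrite muleA -EFinM divff// mul1e.
  by move=> d U c mc; apply: (measurableT_comp mphi); exact: measurable_dotp.
rewrite muleA -EFinM; congr (_%:E * _)%E.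
rewrite exprMn exprVn exprS; field.
by rewrite !gt_eqF ?exprn_gt0.
Qed.

(** The exchange with [H = focal^-n] and gauges [|x|^2] and [focal^2]: the first cutoff gives the
    integrand of the surface integral, the second the indicator of the ellipsoid, and the two radial
    constants [2/n] cancel. *)
Lemma sphere_int_focal n (a : R) (b : 'I_n -> R) : (0 < n)%N ->
  0 < a -> dotp b b < a ^+ 2 ->
  sphere_int (fun x => ((a - dotp b x) ^- n)%:E) =
  (@Asurf R n * (a / Num.sqrt (a ^+ 2 - dotp b b) ^+ n.+1))%:E.
Proof.
move=> n0 a0 ba; have [A0 VE] := @ball_volume_Asurf R n n0.
pose H x := (focal a b x)^-1 ^+ n.
have mH : cmeasurable H.
  move=> d U c mc; apply: measurable_funX; apply: measurable_funV.
  exact: measurable_focal.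
have H0 x : 0 <= H x by rewrite exprn_ge0// invr_ge0 focal_ge0.
have hH r x : 0 < r -> H (scalev r x) = r ^- n * H x.
  by move=> r0; rewrite /H focal_scalev// invfM exprMn !exprVn.
have hN1 r (x : 'I_n -> R) : 0 < r ->
  dotp (scalev r x) (scalev r x) = r ^+ 2 * dotp x x by rewrite dotp_scalev.
pose N2 x := focal a b x ^+ 2.
have mN2 : cmeasurable N2.
  by move=> d U c mc; apply: measurable_funX; exact: measurable_focal.
have hN2 r x : 0 < r -> N2 (scalev r x) = r ^+ 2 * N2 x.
  by move=> r0; rewrite /N2 focal_scalev// exprMn.
have N12 x : (dotp x x == 0) = (N2 x == 0).
  by rewrite /N2 sqrf_eq0 focal_eq0// enorm_eq0.
have := haar_exchange H _ _ _ _ mH measurable_dotpxx mN2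
  (measurable_chi_ball n) (measurable_chi_ball n) H0 dotp_ge0 (fun x => sqr_ge0 _)
  (chi_ball_ge0 n) (chi_ball_ge0 n)
  (chi_ball0 n) (chi_ball0 n) N12 hH hN1 hN2.
rewrite haar_integral_chi_ball// haar_integral_chi_ballE//.
have k0 : 2 / n%:R != 0 :> R by rewrite mulf_neq0 ?invr_eq0 ?pnatr_eq0 -?lt0n.
rewrite ![((2 / n%:R)%:E * _)%E]muleC => /(mulIe_fin _ _ _ k0) HE.
transitivity (n%:R%:E * lebint (fun x => (H x * chi_ball n (dotp x x))%:E))%E.
  congr (_ * _)%E; congr lebint; apply/funext => x.
  rewrite /chi_ball enorm_ball -/(enorm x).
  case: ifPn => [/andP[x0 _]|_]; last by rewrite mulr0.
  rewrite dotpZr /H -exprMn -exprVn; congr (_ ^+ _)%:E.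
  rewrite /focal; field.
  by rewrite -/(focal a b x) !gt_eqF// ?focal_gt0.
rewrite HE (_ : lebint _ = (a / Num.sqrt (a ^+ 2 - dotp b b) ^+ n.+1)%:E * ball_volume n)%E.
  rewrite VE -!EFinM; congr EFin; field.
  by rewrite pnatr_eq0 -lt0n n0 gt_eqF ?exprn_gt0 ?sqrtr_gt0 ?subr_gt0.
rewrite -lebint_focal_le1//.
have [m nE] : exists m, n = m.+1 by exists n.-1; rewrite prednK.
subst n.
apply: lebint_eq_punctured.
- by move=> x; rewrite lee_fin mulr_ge0// chi_ball_ge0.
- by move=> x; rewrite lee_fin; case: ifP.
- move=> d U c mc; apply/measurable_EFinP; apply: measurable_funM; first exact: mH.
  by apply: (measurableT_comp (measurable_chi_ball _)); exact: mN2.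
- move=> d U c mc; apply/measurable_EFinP; apply: measurable_fun_ifT => //.
  by apply: measurable_fun_ler => //; exact: measurable_focal.
- move=> x /enorm_gt0 /(focal_gt0 _ _ _ a0 ba) h0.
  rewrite /chi_ball /N2 exprn_gt0//= sqrtr_sqr gtr0_norm//.
  rewrite expr_le1 ?(ltW h0)//; case: ifP => _; last by rewrite mulr0.
  by rewrite /H -exprMn mulVf ?gt_eqF// expr1n.
Qed.

End focal.

(** * Integrals on the line *)

Section hyperbolic.
Context {R : realType}.
Local Notation mu := (@lebesgue_measure R).

Definition sh2 (t : R) : R := expR t - expR (- t).

Lemma sh2_lt : {homo sh2 : x y / x < y}.
Proof.
by move=> x y xy; rewrite /sh2 ltrB// ltr_expR// ltrN2.
Qed.

Lemma sh2_le : {mono sh2 : x y / x <= y}.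
Proof. exact/le_mono/sh2_lt. Qed.

Lemma sh2_lt_mono : {mono sh2 : x y / x < y}.
Proof. exact/leW_mono/sh2_le. Qed.

(** The logarithm of the positive root [u = e^t] of [u^2 - w u - 1 = 0], that is, of [sh2 t = w]. *)
Definition ash2 (w : R) : R := ln ((w + Num.sqrt (w ^+ 2 + 4)) / 2).

Lemma ash2_arg_gt0 (w : R) : 0 < (w + Num.sqrt (w ^+ 2 + 4)) / 2.
Proof.
rewrite divr_gt0//; have := sqr_ge0 w => w2.
have s0 : 0 < Num.sqrt (w ^+ 2 + 4) by rewrite sqrtr_gt0; lra.
have s2 : Num.sqrt (w ^+ 2 + 4) ^+ 2 = w ^+ 2 + 4 by rewrite sqr_sqrtr; lra.
nra.
Qed.

Lemma expR_ash2 (w : R) : expR (ash2 w) = (w + Num.sqrt (w ^+ 2 + 4)) / 2.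
Proof. by rewrite /ash2 lnK// posrE ash2_arg_gt0. Qed.

Lemma expRN_ash2 (w : R) : expR (- ash2 w) = (Num.sqrt (w ^+ 2 + 4) - w) / 2.
Proof.
have u0 := ash2_arg_gt0 w; rewrite expRN expR_ash2.
apply: (mulIf (lt0r_neq0 u0)); rewrite mulVf ?gt_eqF//.
have s2 : Num.sqrt (w ^+ 2 + 4) ^+ 2 = w ^+ 2 + 4.
  by rewrite sqr_sqrtr; have := sqr_ge0 w; lra.
by nra.
Qed.

Lemma ash2K : cancel ash2 sh2.
Proof. by move=> w; rewrite /sh2 expR_ash2 expRN_ash2; field. Qed.

Lemma is_derive_ash2 (w : R) : is_derive w 1 ash2 (Num.sqrt (w ^+ 2 + 4))^-1.
Proof.
have w4 : 0 < w ^+ 2 + 4 by have := sqr_ge0 w; lra.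
have s0 : 0 < Num.sqrt (w ^+ 2 + 4) by rewrite sqrtr_gt0.
have ds : is_derive w 1 (fun w : R => Num.sqrt (w ^+ 2 + 4)) (w / Num.sqrt (w ^+ 2 + 4)).
  have dg : is_derive w 1 (fun w : R => w ^+ 2 + 4) (2 * w).
    by apply: is_derive_eq; rewrite /GRing.scale/=; ring.
  have dc := @is_derive1_comp _ Num.sqrt (fun w : R => w ^+ 2 + 4) w _ _ (is_derive1_sqrt w4) dg.
  by apply: (is_derive_eq dc); field; rewrite gt_eqF.
have du : is_derive w 1 (fun w : R => (w + Num.sqrt (w ^+ 2 + 4)) / 2)
    ((1 + w / Num.sqrt (w ^+ 2 + 4)) / 2).
  have -> : (fun w : R => (w + Num.sqrt (w ^+ 2 + 4)) / 2) =
     (2^-1 \*: (id + (fun w : R => Num.sqrt (w ^+ 2 + 4)))).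
    by apply/funext => x; rewrite /GRing.scale/= mulrC.
  by apply: is_derive_eq; rewrite /GRing.scale/= mulrC.
have dc := @is_derive1_comp _ (@ln R) _ w _ _ (is_derive1_ln (ash2_arg_gt0 w)) du.
apply: (is_derive_eq dc); have := ash2_arg_gt0 w; rewrite pmulr_lgt0 ?invr_gt0// => u0.
by field; rewrite !gt_eqF.
Qed.

Lemma derive1_ash2 : derive1 ash2 = fun w : R => (Num.sqrt (w ^+ 2 + 4))^-1.
Proof.
by apply/funext => w; rewrite derive1E; apply: derive_val; exact: is_derive_ash2.
Qed.

Lemma ler_norm_sqrt_sqr_add (w c : R) : 0 <= c -> `|w| <= Num.sqrt (w ^+ 2 + c).
Proof. by move=> c0; rewrite -sqrtr_sqr ler_wsqrtr// lerDl. Qed.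

Lemma continuous_sqrt_sqr_add (c : R) : continuous (fun w : R => Num.sqrt (w ^+ 2 + c)).
Proof.
move=> w; apply: (@continuous_comp _ _ _ (fun w : R => w ^+ 2 + c) Num.sqrt).
  by apply: cvgD; [exact: exprn_continuous|exact: cvg_cst].
exact: sqrt_continuous.
Qed.

(* The substitution is made through the inverse [ash2], whose derivative is
   bounded, unlike that of [sh2]. *)
Lemma ge0_integral_sh2 (phi : R -> R) : continuous phi -> (forall w, 0 <= phi w) ->
  (\int[mu]_t ((expR t + expR (- t)) * phi (sh2 t))%:E = \int[mu]_w (phi w)%:E)%E.
Proof.
move=> cphi phi0.
have csh : continuous sh2.
  move=> t; apply: cvgB; first exact: continuous_expR.
  by apply: (@continuous_comp _ _ _ (fun t : R => - t) expR);
    [exact: continuousN|exact: continuous_expR].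
have s4 (w : R) : 0 < Num.sqrt (w ^+ 2 + 4).
  by rewrite sqrtr_gt0; have := sqr_ge0 w; lra.
(* The substitution rule asks for limits of the derivative of [ash2] at both infinities; stating
   this for a filter on which [|w|] is unbounded treats both ends together. *)
have lim0 (F : set_system R) : Filter F -> (forall A, \forall w \near F, A <= `|w|) ->
    (Num.sqrt (w ^+ 2 + 4))^-1 @[w --> F] --> (0 : R).
  move=> FF FA; apply/gtr0_cvgV0; first by near=> w.
  apply/cvgryPge => A; near=> w.
  apply: (@le_trans _ _ `|w|); first by near: w; exact: FA.
  exact: ler_norm_sqrt_sqr_add.
rewrite (@increasing_ge0_integration_by_substitutionT _ ash2
    (fun t => (expR t + expR (- t)) * phi (sh2 t))).
- apply: eq_integral => w _; congr EFin; rewrite derive1_ash2 /=.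
  rewrite fctE /comp ash2K expR_ash2 expRN_ash2; field.
  by rewrite gt_eqF.
- by move=> x y xy; rewrite -sh2_lt_mono !ash2K.
- rewrite derive1_ash2 => w; apply: cvgV; first by rewrite gt_eqF.
  exact: continuous_sqrt_sqr_add.
- rewrite derive1_ash2; apply/cvg_ex; exists 0; apply: lim0 => A.
  near=> w; rewrite ler_normr; apply/orP; right.
  by rewrite lerNr; near: w; apply: nbhs_ninfty_le; exact: num_real.
- rewrite derive1_ash2; apply/cvg_ex; exists 0; apply: lim0 => A.
  near=> w; rewrite ler_normr; apply/orP; left.
  by near: w; apply: nbhs_pinfty_ge; exact: num_real.
- by move=> w; apply: ex_derive; exact: is_derive_ash2.
- apply/cvgrNyPle => A; near=> w; rewrite -sh2_le ash2K.
  by near: w; apply: nbhs_ninfty_le; exact: num_real.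
- apply/cvgryPge => A; near=> w; rewrite -sh2_le ash2K.
  by near: w; apply: nbhs_pinfty_ge; exact: num_real.
- move=> t; apply: cvgM; last first.
    by apply: (@continuous_comp _ _ _ sh2 phi); [exact: csh|exact: cphi].
  apply: cvgD; first exact: continuous_expR.
  by apply: (@continuous_comp _ _ _ (fun t : R => - t) expR);
    [exact: continuousN|exact: continuous_expR].
- by move=> t; rewrite mulr_ge0// addr_ge0// expR_ge0.
Unshelve. all: by end_near. Qed.

End hyperbolic.

(** * Integrals over the auxiliary parameter *)

Section line_integrals.
Context {R : realType}.
Local Notation mu := (@lebesgue_measure R).

(** The integral of [(2 cosh t)^-n]. Its value is never computed: only its ratio to
    [cauchy_integral n] matters. *)
Definition sech_integral n : \bar R :=
  (\int[mu]_t ((expR t + expR (- t)) ^- n)%:E)%E.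

Definition cauchy_integral n : \bar R :=
  (\int[mu]_w (Num.sqrt (w ^+ 2 + 1) ^- n.+1)%:E)%E.

Lemma measurable_expRN : measurable_fun [set: R] (fun t : R => expR (- t)).
Proof. exact: (measurableT_comp (@measurable_expR R)). Qed.

Lemma measurable_exp_comb (x y : R) :
  measurable_fun [set: R] (fun t => expR t * x + expR (- t) * y).
Proof.
by apply: measurable_funD; apply: measurable_funM => //; exact: measurable_expRN.
Qed.

Lemma exp_comb_gt0 (x y t : R) : 0 < x -> 0 < y -> 0 < expR t * x + expR (- t) * y.
Proof. by move=> x0 y0; rewrite addr_gt0// mulr_gt0// expR_gt0. Qed.

(* Translating [t] by [ln (sqrt y / sqrt x)] turns both coefficients into
   [sqrt (x * y)]. *)
Lemma feynman n (x y : R) : 0 < x -> 0 < y ->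
  (\int[mu]_t ((expR t * x + expR (- t) * y) ^- n)%:E =
   (Num.sqrt (x * y) ^- n)%:E * sech_integral n)%E.
Proof.
move=> x0 y0; set k := Num.sqrt y / Num.sqrt x.
have k0 : 0 < k by rewrite divr_gt0// sqrtr_gt0.
pose f t := ((expR t * x + expR (- t) * y) ^- n)%:E.
have mf : measurable_fun [set: R] f.
  apply/measurable_EFinP; apply: measurable_funV; apply: measurable_funX.
  exact: measurable_exp_comb.
have f0 t : (0 <= f t)%E.
  by rewrite lee_fin invr_ge0 exprn_ge0// ltW// exp_comb_gt0.
rewrite -(integral_translation (ln k) f mf f0) -ge0_integralZl//.
- apply: eq_integral => t _; rewrite /f -EFinM -invfM -exprMn; congr (_ ^- _)%:E.
  rewrite opprD !expRD expRN lnK ?posrE// expRN lnK ?posrE// /k sqrtrM ?ltW//.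
  rewrite -[X in _ * X + _](sqr_sqrtr (ltW x0)) -[X in _ + _ * X = _](sqr_sqrtr (ltW y0)).
  by field; rewrite !gt_eqF ?sqrtr_gt0 ?expR_gt0.
- apply/measurable_EFinP; apply: measurable_funV; apply: measurable_funX.
  by apply: measurable_funD => //; exact: measurable_expRN.
Qed.

Lemma sqr_add_gt0 (x c : R) : 0 < c -> 0 < Num.sqrt (x ^+ 2 + c).
Proof. by move=> c0; rewrite sqrtr_gt0 ltr_wpDl// sqr_ge0. Qed.

Lemma integral_scaled_cauchy n (m c : R) : 0 < m -> 0 < c ->
  (\int[mu]_w (Num.sqrt ((m * w) ^+ 2 + c ^+ 2) ^- n.+1)%:E =
   ((m * c ^+ n)^-1)%:E * cauchy_integral n)%E.
Proof.
move=> m0 c0; pose f (w : R) := (Num.sqrt (w ^+ 2 + 1) ^- n.+1)%:E.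
have mf : measurable_fun [set: R] f.
  apply/measurable_EFinP; apply: measurable_funV; apply: measurable_funX.
  by apply: continuous_measurable_fun; exact: continuous_sqrt_sqr_add.
have f0 t : (0 <= f t)%E by rewrite lee_fin invr_ge0 exprn_ge0.
have mc0 : 0 < m / c by rewrite divr_gt0.
have cn0 : 0 < c ^- n.+1 by rewrite invr_gt0 exprn_gt0.
transitivity (\int[mu]_w ((c ^- n.+1)%:E * f (m / c * w)%R))%E.
  apply: eq_integral => w _; rewrite /f -EFinM -invfM -exprMn; congr (_ ^- _)%:E.
  rewrite -[X in _ = X * _](gtr0_norm c0) -sqrtr_sqr -sqrtrM ?sqr_ge0//.
  by congr Num.sqrt; field; rewrite gt_eqF.
rewrite ge0_integralZl//; last first.
- by rewrite lee_fin ltW.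
- by apply: (measurableT_comp mf).
rewrite integral_scale// muleA -EFinM; congr (_%:E * _)%E.
by rewrite exprS; field; rewrite !gt_eqF ?exprn_gt0.
Qed.

Lemma continuous_cauchy_density n (m c : R) : 0 < c ^+ 2 ->
  continuous (fun w : R => Num.sqrt ((m * w) ^+ 2 + c ^+ 2) ^- n.+1).
Proof.
move=> c20 w; apply: cvgV.
  by rewrite expf_neq0// gt_eqF// sqr_add_gt0.
apply: (@continuous_comp _ _ _ (fun w : R => Num.sqrt ((m * w) ^+ 2 + c ^+ 2))
  (fun z => z ^+ n.+1)); last exact: exprn_continuous.
apply: (@continuous_comp _ _ _ (fun w : R => m * w)
  (fun z => Num.sqrt (z ^+ 2 + c ^+ 2))); first exact: mulrl_continuous.
exact: continuous_sqrt_sqr_add.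
Qed.

Lemma mule_half2 (x : \bar R) : x = ((2^-1)%:E * (2%:E * x))%E.
Proof. by rewrite muleA -EFinM mulVf ?pnatr_eq0// mul1e. Qed.

(* After a translation the denominator is even in [t], so that the two
   exponentials of the numerator contribute equally and may be replaced by a
   multiple of the derivative of [sh2]. *)
Lemma integral_exp_comb n (p q x y c : R) : 0 < p -> 0 < q -> 0 < x -> 0 < y -> 0 < c ->
  (\int[mu]_t ((expR t * x + expR (- t) * y) /
     Num.sqrt ((expR t * p - expR (- t) * q) ^+ 2 + c ^+ 2) ^+ n.+1)%:E =
   ((q * x + p * y) / (2 * p * q * c ^+ n))%:E * cauchy_integral n)%E.
Proof.
move=> p0 q0 x0 y0 c0.
have c20 : 0 < c ^+ 2 by rewrite exprn_gt0.
set sp := Num.sqrt p; set sq := Num.sqrt q.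
have sp0 : 0 < sp by rewrite sqrtr_gt0.
have sq0 : 0 < sq by rewrite sqrtr_gt0.
have pE : p = sp ^+ 2 by rewrite sqr_sqrtr// ltW.
have qE : q = sq ^+ 2 by rewrite sqr_sqrtr// ltW.
clearbody sp sq.
(* Shifting [t] by [ln (sq / sp)] gives [e^t p] and [e^-t q] the common coefficient
   [m = sp * sq]. *)
have k0 : 0 < sq / sp by rewrite divr_gt0.
have expRk t : expR (t + ln (sq / sp)) = expR t * (sq / sp).
  by rewrite expRD lnK ?posrE.
have expRNk t : expR (- (t + ln (sq / sp))) = expR (- t) * (sp / sq).
  have kV : expR (- ln (sq / sp)) = sp / sq.
    by rewrite expRN lnK; [exact: invf_div|rewrite posrE].
  by rewrite opprD expRD kV.
have kx0 : 0 <= sq / sp * x by rewrite mulr_ge0// ltW.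
have ky0 : 0 <= sp / sq * y by rewrite mulr_ge0 ?divr_ge0// ltW.
pose m := sp * sq; have m0 : 0 < m by rewrite mulr_gt0.
pose f t := ((expR t * x + expR (- t) * y) /
     Num.sqrt ((expR t * p - expR (- t) * q) ^+ 2 + c ^+ 2) ^+ n.+1)%:E.
have msqrt (r s : R) :
    measurable_fun [set: R] (fun t =>
      Num.sqrt ((expR t * r - expR (- t) * s) ^+ 2 + c ^+ 2) ^- n.+1).
  apply: measurable_funV; apply: measurable_funX.
  apply: (measurableT_comp measurable_sqrt); apply: measurable_funD => //.
  apply: measurable_funX; apply: measurable_funB; apply: measurable_funM => //.
  exact: measurable_expRN.
have sqrt0 (r s t : R) : 0 <= Num.sqrt ((expR t * r - expR (- t) * s) ^+ 2 + c ^+ 2) ^- n.+1.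
  by rewrite invr_ge0 exprn_ge0.
have mf : measurable_fun [set: R] f.
  by apply/measurable_EFinP; apply: measurable_funM => //; exact: measurable_exp_comb.
have f0 t : (0 <= f t)%E.
  by rewrite lee_fin mulr_ge0// ltW// exp_comb_gt0.
pose G (t : R) := Num.sqrt ((expR t * m - expR (- t) * m) ^+ 2 + c ^+ 2) ^- n.+1.
have G0 t : 0 <= G t by exact: sqrt0.
have mG : measurable_fun [set: R] G by exact: msqrt.
pose g t := (expR t * G t)%:E.
have mg : measurable_fun [set: R] g.
  by apply/measurable_EFinP; apply: measurable_funM.
have g0 t : (0 <= g t)%E by rewrite lee_fin mulr_ge0// expR_ge0.
have GN t : G (- t) = G t.
  by rewrite /G opprK -sqrrN opprB.
have gN : (\int[mu]_t g (- t)%R = \int[mu]_t g t)%E by exact: integral_reflection.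
have mgN : measurable_fun [set: R] (fun t : R => g (- t)).
  by apply: (measurableT_comp mg).
(* By reflection only [u + v] matters, so the integral of [g] can be read off from [u = v = 1],
   where the numerator is the derivative of [sh2]. *)
have comb (u v : R) : 0 <= u -> 0 <= v ->
    (\int[mu]_t ((expR t * u + expR (- t) * v) * G t)%:E = (u + v)%:E * \int[mu]_t g t)%E.
  move=> u0 v0.
  transitivity (\int[mu]_t (u%:E * g t + v%:E * g (- t)%R))%E.
    apply: eq_integral => t _; rewrite /g -!EFinM -EFinD GN; congr EFin.
    by ring.
  have u0E : (0 <= u%:E)%E by [].
  have v0E : (0 <= v%:E)%E by [].
  have h1_ge0 (t : R) : [set: R] t -> (0 <= u%:E * g t)%E by rewrite mule_ge0.
  have h2_ge0 (t : R) : [set: R] t -> (0 <= v%:E * g (- t)%R)%E by rewrite mule_ge0.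
  have mh1 : measurable_fun [set: R] (fun t => u%:E * g t)%E by exact: measurable_funeM.
  have mh2 : measurable_fun [set: R] (fun t => v%:E * g (- t)%R)%E.
    exact: measurable_funeM.
  rewrite (ge0_integralD mu measurableT h1_ge0 mh1 h2_ge0 mh2).
  rewrite (ge0_integralZl mu measurableT mg (fun t _ => g0 t) u0E).
  rewrite (ge0_integralZl mu measurableT mgN (fun t _ => g0 (- t)) v0E).
  by rewrite gN -ge0_muleDl// EFinD.
rewrite -(integral_translation (ln (sq / sp)) f mf f0).
transitivity (\int[mu]_t ((expR t * (sq / sp * x) + expR (- t) * (sp / sq * y)) * G t)%:E)%E.
  apply: eq_integral => t _; rewrite /f /G /m expRk expRNk.
  congr ((_ / Num.sqrt (_ ^+ 2 + _) ^+ _)%:E); last first.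
    by rewrite pE qE; field; rewrite !gt_eqF.
  by ring.
rewrite (comb _ _ kx0 ky0) {f0 mf sqrt0}.
have J : (2%:E * \int[mu]_t g t = ((m * c ^+ n)^-1)%:E * cauchy_integral n)%E.
  have phi0 (w : R) : 0 <= Num.sqrt ((m * w) ^+ 2 + c ^+ 2) ^- n.+1.
    by rewrite invr_ge0 exprn_ge0.
  rewrite -(integral_scaled_cauchy n m c m0 c0).
  rewrite -(ge0_integral_sh2 _ (continuous_cauchy_density n m c c20) phi0).
  have -> : 2%:E = (1 + 1)%:E :> \bar R by [].
  rewrite -(comb _ _ ler01 ler01).
  apply: eq_integral => t _; rewrite !mulr1 /G /sh2 [m * (_ - _)]mulrC mulrBl.
  by [].
rewrite [X in (_ * X)%E]mule_half2 J !muleA -!EFinM; congr (_%:E * _)%E.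
clear -m0 sp0 sq0 c0 pE qE; rewrite /m pE qE; field.
by rewrite !gt_eqF ?exprn_gt0.
Qed.

(** This allows the constant to be cancelled. Since the base is at least 1 and [n + 1 >= 2], the
    integral is at most that of [1 / (1 + w^2)], which is [pi]; it is bounded below on [[0, 1]],
    where the base is at most [sqrt 2]. *)
Lemma cauchy_integral_fin n : (0 < n)%N ->
  exists2 C : R, 0 < C & cauchy_integral n = C%:E.
Proof.
move=> n0; pose f (w : R) := (Num.sqrt (w ^+ 2 + 1) ^- n.+1)%:E.
have mf : measurable_fun [set: R] f.
  apply/measurable_EFinP; apply: measurable_funV; apply: measurable_funX.
  by apply: continuous_measurable_fun; exact: continuous_sqrt_sqr_add.
have f0 t : (0 <= f t)%E by rewrite lee_fin invr_ge0 exprn_ge0.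
have s0 (w : R) : 0 < Num.sqrt (w ^+ 2 + 1) by exact: sqr_add_gt0.
have s1 (w : R) : 1 <= Num.sqrt (w ^+ 2 + 1).
  by rewrite -[leLHS]sqrtr1 ler_wsqrtr// lerDr sqr_ge0.
have upper : (cauchy_integral n <= pi%:E)%E.
  have -> : pi%:E = (\int[mu]_w ((@oneDsqr R w)^-1)%:E)%E.
    rewrite (@ge0_symfun_integralT _ (fun w => (@oneDsqr R w)^-1)).
    - rewrite -set_itvcy integral0y_oneDsqr -EFinM; congr EFin.
      by rewrite mulrC divfK.
    - by move=> w; rewrite invr_ge0 addr_ge0// sqr_ge0.
    - exact: continuous_oneDsqrV.
    - by move=> w; rewrite /oneDsqr /= sqrrN.
  apply: ge0_le_integral => //.
  - apply/measurable_EFinP; apply: continuous_measurable_fun.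
    exact: continuous_oneDsqrV.
  - move=> w _; have o0 : 0 < oneDsqr w by exact: lt_le_trans (oneDsqr_ge1 w).
    have e0 : 0 < Num.sqrt (w ^+ 2 + 1) ^+ n.+1 by rewrite exprn_gt0.
    rewrite lee_fin lef_pV2 ?posrE// /oneDsqr addrC.
    rewrite -[leLHS]sqr_sqrtr ?addr_ge0 ?sqr_ge0//.
    exact: ler_weXn2l.
have lower : ((Num.sqrt 2 ^- n.+1)%:E <= cauchy_integral n)%E.
  apply: (@le_trans _ _ (\int[mu]_(w in `[0%R, 1%R]) (Num.sqrt 2 ^- n.+1)%:E)%E).
    have mu01 : mu `[0%R, 1%R] = 1%E.
      by rewrite lebesgue_measure_itv/= lte_fin ltr01 oppr0 adde0.
    by rewrite integral_cst//= [X in (_ * X)%E]mu01 mule1.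
  apply: (@le_trans _ _ (\int[mu]_(w in `[0%R, 1%R]) f w)%E).
    apply: ge0_le_integral => //.
    - exact: measurable_funTS.
    - move=> w /=; rewrite in_itv/= => /andP[w0 w1].
      rewrite lee_fin lef_pV2 ?posrE ?exprn_gt0// ?sqrtr_gt0//.
      rewrite lerXn2r ?nnegrE// ler_wsqrtr//.
      by nra.
  exact: ge0_subset_integral.
have C0 : (0 < cauchy_integral n)%E.
  by apply: lt_le_trans lower; rewrite lte_fin invr_gt0 exprn_gt0// sqrtr_gt0.
have Cy : (cauchy_integral n < +oo)%E by apply: (le_lt_trans upper); exact: ltry.
exists (fine (cauchy_integral n)); first by rewrite fine_gt0// C0.
by rewrite fineK// ge0_fin_numE// ltW.
Qed.

End line_integrals.

(** * Products of Poisson kernels *)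

Section product.
Context {R : realType}.
Local Notation mu := (@lebesgue_measure R).

Lemma eq_sphere_int {n} (f g : ('I_n -> R) -> \bar R) :
  (forall x, enorm x = 1 -> f x = g x) -> sphere_int f = sphere_int g.
Proof.
move=> fg; congr (_ * _)%E; congr lebint; apply/funext => x.
case: ifPn => // /andP[x0 _]; apply: fg.
by rewrite enorm_scalev ?invr_ge0 ?ltW// mulVf// gt_eqF.
Qed.

Lemma measurable_sphere_integrand {n d} {T : measurableType d}
    (F : T -> ('I_n -> R) -> \bar R) : pmeasurable F ->
  pmeasurable (fun t x => if (0 < enorm x) && (enorm x <= 1)
                          then F t (scalev (enorm x)^-1 x) else 0%E).
Proof.
move=> pF d' U g c mg mc; have me := measurable_enorm _ _ _ mc.
apply: measurable_fun_ifT => //.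
  by apply: measurable_and; [exact: measurable_fun_ltr|exact: measurable_fun_ler].
apply: pF => // i; apply: measurable_funM => //.
exact: measurable_funV.
Qed.

Lemma sphere_intZl {n} (k : \bar R) (f : ('I_n -> R) -> \bar R) :
  (0 <= k)%E -> (forall x, enorm x = 1%R -> 0 <= f x)%E -> cmeasurable f ->
  sphere_int (fun x => k * f x)%E = (k * sphere_int f)%E.
Proof.
move=> k0 f0 mf; rewrite /sphere_int muleCA -[in RHS]lebintZl//.
- congr (_ * _)%E; congr lebint; apply/funext => x.
  by case: ifP => //; rewrite mule0.
- move=> x; case: ifPn => // /andP[x0 _]; apply: f0.
  by rewrite enorm_scalev ?invr_ge0 ?ltW// mulVf// gt_eqF.
- move=> d U c mc.
  have pf : pmeasurable (fun _ : U => f) by move=> d' V g e _; exact: mf.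
  exact: (measurable_sphere_integrand _ pf _ U id c).
Qed.

Lemma sphere_int_tonelli {n} (F : R -> ('I_n -> R) -> \bar R) :
  (forall t x, enorm x = 1%R -> 0 <= F t x)%E -> pmeasurable F ->
  sphere_int (fun x => \int[mu]_t F t x)%E = (\int[mu]_t sphere_int (F t))%E.
Proof.
move=> F0 mF; pose G t x := if (0 < enorm x) && (enorm x <= 1)
                          then F t (scalev (enorm x)^-1 x) else 0%E.
have G0 t x : (0 <= G t x)%E.
  rewrite /G; case: ifPn => // /andP[x0 _]; apply: F0.
  by rewrite enorm_scalev ?invr_ge0 ?ltW// mulVf// gt_eqF.
have mG : pmeasurable G by exact: measurable_sphere_integrand.
rewrite /sphere_int [RHS]ge0_integralZl//.
- rewrite -lebint_tonelli//; congr (_ * _)%E; congr lebint; apply/funext => x.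
  by rewrite /G; case: ifP => // _; rewrite integral0.
- exact: measurable_lebint.
- by move=> t _; apply: lebint_ge0 => x; exact: (G0 t x).
Qed.

Section poisson_kernels.
Variables (d : nat) (rho1 rho2 : R) (eta1 eta2 : 'I_d -> R).
Hypotheses (d2 : (2 <= d)%N) (r1 : 0 <= rho1 < 1) (r2 : 0 <= rho2 < 1).
Hypotheses (e1 : dotp eta1 eta1 = 1) (e2 : dotp eta2 eta2 = 1).

Let c := dotp eta1 eta2.
Let D := 1 + rho1 ^+ 2 * rho2 ^+ 2 - 2 * rho1 * rho2 * c.

Lemma dotp_unit_le1 (x y : 'I_d -> R) : dotp x x = 1 -> dotp y y = 1 -> dotp x y <= 1.
Proof.
move=> x1 y1; have := ler_dotp_enorm x y.
by rewrite /enorm x1 y1 !sqrtr1 mulr1.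
Qed.

(** As [c <= 1], [D] is at least [(1 - rho1 rho2)^2]. *)
Lemma kernel_discriminant_gt0 : 0 < D.
Proof.
have c1 : c <= 1 by exact: dotp_unit_le1.
move: r1 r2 => /andP[r10 r11] /andP[r20 r21].
have r : 0 <= rho1 * rho2 by rewrite mulr_ge0.
have r' : rho1 * rho2 < 1 by nra.
rewrite /D; nra.
Qed.

Lemma dotp_subsc rho (x eta : 'I_d -> R) : dotp x x = 1 -> dotp eta eta = 1 ->
  dotp (subsc x rho eta) (subsc x rho eta) = 1 + rho ^+ 2 - 2 * rho * dotp x eta.
Proof.
move=> x1 eta1'.
have -> : subsc x rho eta = fun i => x i + - rho * eta i.
  by apply/funext => i; rewrite /subsc mulNr.
rewrite !(dotpDl, dotpDr, dotpZl, dotpZr) x1 eta1' (dotpC eta x).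
by ring.
Qed.

Lemma kernel_gt0 rho (x eta : 'I_d -> R) : 0 <= rho < 1 ->
  dotp x x = 1 -> dotp eta eta = 1 -> 0 < 1 + rho ^+ 2 - 2 * rho * dotp x eta.
Proof.
move=> /andP[r0 r1'] x1 eta1'; have := dotp_unit_le1 x eta x1 eta1'.
by nra.
Qed.

Lemma measurable_kernel_product : cmeasurable (fun x : 'I_d -> R =>
  ((enorm (subsc x rho1 eta1) * enorm (subsc x rho2 eta2)) ^- d)%:E).
Proof.
have msubsc rho (eta : 'I_d -> R) d' (U : measurableType d') (x : 'I_d -> U -> R) :
    (forall i, measurable_fun [set: U] (x i)) ->
    measurable_fun [set: U] (fun u => enorm (subsc (fun i => x i u) rho eta)).
  move=> mx; apply: (measurable_enorm _ U (fun i u => x i u - rho * eta i)) => i.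
  exact: measurable_funB.
move=> d' U x mx; apply/measurable_EFinP; apply: measurable_funV.
by apply: measurable_funX; apply: measurable_funM; exact: msubsc.
Qed.

Lemma sech_sphere_int_kernels :
  (sech_integral d * sphere_int (fun x =>
     ((enorm (subsc x rho1 eta1) * enorm (subsc x rho2 eta2)) ^- d)%:E) =
   (@Asurf R d * ((1 - rho1 ^+ 2 * rho2 ^+ 2) /
     ((1 - rho1 ^+ 2) * (1 - rho2 ^+ 2) * (2 * Num.sqrt D) ^+ d)))%:E *
   cauchy_integral d)%E.
Proof.
have d0 : (0 < d)%N by exact: leq_trans d2.
have D0 := kernel_discriminant_gt0.
have [A0 _] := @ball_volume_Asurf R d d0.
have p0 : 0 < 1 - rho1 ^+ 2 by move: r1 => /andP[? ?]; nra.
have q0 : 0 < 1 - rho2 ^+ 2 by move: r2 => /andP[? ?]; nra.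
pose al1 := 1 + rho1 ^+ 2; pose al2 := 1 + rho2 ^+ 2.
have al10 : 0 < al1 by rewrite ltr_pwDl// sqr_ge0.
have al20 : 0 < al2 by rewrite ltr_pwDl// sqr_ge0.
(* On the sphere [a t - b t . x] is [e^t L1 + e^-t L2]. *)
pose a t := expR t * al1 + expR (- t) * al2.
pose b t (i : 'I_d) := expR t * (2 * rho1) * eta1 i + expR (- t) * (2 * rho2) * eta2 i.
have a0 t : 0 < a t by exact: exp_comb_gt0.
have bx t x : dotp (b t) x =
    expR t * (2 * rho1) * dotp x eta1 + expR (- t) * (2 * rho2) * dotp x eta2.
  by rewrite /b dotpDl !dotpZl !(dotpC x).
(* The squares combine through [(1 + rho^2)^2 - 4 rho^2 = (1 - rho^2)^2]. Since [e^t e^-t = 1], the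
   cross terms are constant, and completing the square on the right leaves exactly [4 D]. *)
have abE t : a t ^+ 2 - dotp (b t) (b t) =
    (expR t * (1 - rho1 ^+ 2) - expR (- t) * (1 - rho2 ^+ 2)) ^+ 2 +
    (2 * Num.sqrt D) ^+ 2.
  rewrite exprMn sqr_sqrtr ?ltW// /D !bx e1 e2 (dotpC eta2) -/c.
  have EE : expR t * expR (- t) = 1 by rewrite -expRD subrr expR0.
  transitivity ((expR t * (1 - rho1 ^+ 2)) ^+ 2 + (expR (- t) * (1 - rho2 ^+ 2)) ^+ 2 +
     2 * (expR t * expR (- t)) * (al1 * al2 - 4 * rho1 * rho2 * c)).
    by rewrite /a /al1 /al2; ring.
  transitivity ((expR t * (1 - rho1 ^+ 2)) ^+ 2 + (expR (- t) * (1 - rho2 ^+ 2)) ^+ 2 -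
     2 * (expR t * expR (- t)) * ((1 - rho1 ^+ 2) * (1 - rho2 ^+ 2)) +
     2 ^+ 2 * (1 + rho1 ^+ 2 * rho2 ^+ 2 - 2 * rho1 * rho2 * c)); last by ring.
  by rewrite EE /al1 /al2; ring.
have ba t : dotp (b t) (b t) < a t ^+ 2.
  by rewrite -subr_gt0 abE ltr_wpDl ?sqr_ge0// exprn_gt0// mulr_gt0// sqrtr_gt0.
have sC : (0 <= sech_integral d :> \bar R)%E.
  apply: integral_ge0 => t _; rewrite lee_fin invr_ge0 exprn_ge0// addr_ge0//;
  exact: expR_ge0.
rewrite -sphere_intZl//; last first.
- exact: measurable_kernel_product.
- by move=> x _; rewrite lee_fin invr_ge0 exprn_ge0// mulr_ge0// enorm_ge0.
transitivity (sphere_int (fun x => \int[mu]_t ((a t - dotp (b t) x) ^- d)%:E)%E).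
  apply: eq_sphere_int => x x1.
  have x1' : dotp x x = 1 by rewrite -sqr_enorm x1 expr1n.
  have L1 := kernel_gt0 _ _ _ r1 x1' e1; have L2 := kernel_gt0 _ _ _ r2 x1' e2.
  rewrite /enorm !dotp_subsc// -sqrtrM ?ltW// muleC -feynman//.
  by apply: eq_integral => t _; rewrite bx /a /al1 /al2; congr (_ ^- _)%:E; ring.
rewrite sphere_int_tonelli; first last.
- move=> d' U g x mg mx; apply/measurable_EFinP; apply: measurable_funV.
  apply: measurable_funX; apply: measurable_funB.
    by apply: (measurableT_comp _ mg); exact: measurable_exp_comb.
  under eq_fun do rewrite bx.
  have mE := measurableT_comp (@measurable_expR R) mg.
  have mEN := measurableT_comp (@measurable_expRN R) mg.
  by apply: measurable_funD; apply: measurable_funM;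
    [exact: measurable_funM|exact: measurable_dotp|
     exact: measurable_funM|exact: measurable_dotp].
- move=> t x x1; rewrite lee_fin invr_ge0 exprn_ge0//.
  rewrite subr_ge0 (le_trans (ler_dotp_enorm _ _))// x1 mulr1 ltW//.
  exact: (enorm_lt _ _ _ (a0 t) (ba t)).
under eq_integral => t _.
  rewrite (sphere_int_focal _ _ _ d0 (a0 t) (ba t)) abE EFinM.
  over.
have sD0 : 0 < 2 * Num.sqrt D by rewrite mulr_gt0// sqrtr_gt0.
rewrite ge0_integralZl//; first last.
- by rewrite lee_fin ltW.
- by move=> t _; rewrite lee_fin divr_ge0// ?exprn_ge0// ltW.
- apply/measurable_EFinP; apply: measurable_funM; first exact: measurable_exp_comb.
  apply: measurable_funV; apply: measurable_funX.
  apply: (measurableT_comp measurable_sqrt); apply: measurable_funD => //.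
  apply: measurable_funX; apply: measurable_funB; apply: measurable_funM => //.
  exact: measurable_expRN.
rewrite (integral_exp_comb d _ _ _ _ _ p0 q0 al10 al20 sD0) muleA -EFinM.
congr (_%:E * _)%E; congr (_ * _).
(* The numerator arises here: [(1 - rho2^2) al1 + (1 - rho1^2) al2 = 2 (1 - rho1^2 rho2^2)]. *)
rewrite /al1 /al2; field.
by rewrite !gt_eqF// ?exprn_gt0.
Qed.

End poisson_kernels.

End product.

(** * Calibration of the constants *)

Section poisson_product.
Context {R : realType}.

Lemma sphere_int1 d : (0 < d)%N ->
  sphere_int (fun _ : 'I_d -> R => 1%:E) = (@Asurf R d)%:E.
Proof.
move=> d0; pose b (i : 'I_d) : R := 0.
have b0 x : dotp b x = 0 by rewrite /dotp big1// => i _; rewrite mul0r.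
have bb : dotp b b < 1 ^+ 2 by rewrite b0 expr1n.
have := sphere_int_focal d 1 b d0 ltr01 bb.
rewrite b0 subr0 expr1n sqrtr1 expr1n divr1 mulr1 => <-.
by congr sphere_int; apply/funext => x; rewrite b0 subr0 expr1n invr1.
Qed.

(** For [rho1 = rho2 = 0] both kernels are 1 on the sphere and the discriminant is 1, so the product
    formula becomes a relation between the two line integrals alone. *)
Lemma sech_integralE d (eta : 'I_d -> R) : (2 <= d)%N -> dotp eta eta = 1 ->
  sech_integral d = ((2 ^- d)%:E * @cauchy_integral R d)%E.
Proof.
move=> d2 e1; have d0 : (0 < d)%N by exact: leq_trans d2.
have [A0 _] := @ball_volume_Asurf R d d0.
have z : 0 <= (0 : R) < 1 by rewrite lexx ltr01.
have := sech_sphere_int_kernels d 0 0 eta eta d2 z z e1 e1.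
rewrite (@eq_sphere_int _ _ _ (fun=> 1%:E)); last first.
  move=> x x1; have -> : subsc x 0 eta = x.
    by apply/funext => i; rewrite /subsc mul0r subr0.
  by rewrite x1 mulr1 expr1n invr1.
rewrite sphere_int1//; move: (@Asurf R d) A0 => A A0.
rewrite !expr0n/= !(mulr0, mul0r, subr0, addr0) sqrtr1 !mulr1 !mul1r => HA.
apply: (mulIe_fin _ _ _ (lt0r_neq0 A0)).
by rewrite HA EFinM [RHS]muleC muleA.
Qed.

Lemma sphere_int_kernels d (rho1 rho2 : R) (eta1 eta2 : 'I_d -> R) :
  (2 <= d)%N -> 0 <= rho1 < 1 -> 0 <= rho2 < 1 ->
  dotp eta1 eta1 = 1 -> dotp eta2 eta2 = 1 ->
  sphere_int (fun x =>
     ((enorm (subsc x rho1 eta1) * enorm (subsc x rho2 eta2)) ^- d)%:E) =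
  (@Asurf R d * ((1 - rho1 ^+ 2 * rho2 ^+ 2) /
     ((1 - rho1 ^+ 2) * (1 - rho2 ^+ 2) *
      Num.sqrt (1 + rho1 ^+ 2 * rho2 ^+ 2 - 2 * rho1 * rho2 * dotp eta1 eta2) ^+ d)))%:E.
Proof.
move=> d2 r1 r2 e1 e2; have d0 : (0 < d)%N by exact: leq_trans d2.
have D0 := kernel_discriminant_gt0 d _ _ _ _ r1 r2 e1 e2.
have := sech_sphere_int_kernels d _ _ _ _ d2 r1 r2 e1 e2.
have [C C0 CE] := @cauchy_integral_fin R d d0.
rewrite (sech_integralE d eta1 d2 e1) CE -!EFinM [LHS]muleC => HS.
have k0 : 2 ^- d * C != 0 by rewrite gt_eqF// mulr_gt0// invr_gt0 exprn_gt0.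
apply: (mulIe_fin _ _ _ k0); rewrite HS -EFinM; congr EFin.
have p0 : 1 - rho1 ^+ 2 != 0 by rewrite gt_eqF//; move: r1 => /andP[? ?]; nra.
have q0 : 1 - rho2 ^+ 2 != 0 by rewrite gt_eqF//; move: r2 => /andP[? ?]; nra.
rewrite exprMn; field.
by rewrite p0 q0 !gt_eqF ?exprn_gt0 ?sqrtr_gt0.
Qed.

End poisson_product.

(** * The posterior density *)

Theorem theorem11 (R : realType) (d : nat) (rho1 rho2 : R)
    (eta1 eta2 : 'I_d -> R) :
  (2 <= d)%N ->
  0 <= rho1 < 1 -> 0 <= rho2 < 1 ->
  eta1 \in @sphere R d -> eta2 \in @sphere R d ->
  let lik := fun xi x => @exit_density R d rho1 xi x in
  let prior := fun xi => @exit_density R d rho2 eta2 xi in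
  (0 < marginal_density lik prior eta1 < +oo)%E /\
  forall xi, xi \in @sphere R d ->
    posterior_density lik prior eta1 xi =
      (@Asurf R d)^-1 *
      ((1 + rho1 ^+ 2 * rho2 ^+ 2 - 2 * rho1 * rho2 * dotp eta1 eta2)
          `^ (d%:R / 2) / (1 - rho1 ^+ 2 * rho2 ^+ 2)) *
      ((1 - rho1 ^+ 2) / enorm (subsc xi rho1 eta1) ^+ d) *
      ((1 - rho2 ^+ 2) / enorm (subsc xi rho2 eta2) ^+ d).
Proof.
move=> d2 r1 r2 /[!inE] e1 e2 lik prior.
have unit (x : 'I_d -> R) : enorm x = 1 -> dotp x x = 1.
  by move=> x1; rewrite -sqr_enorm x1 expr1n.
have {}e1 : dotp eta1 eta1 = 1 by exact: unit.
have {}e2 : dotp eta2 eta2 = 1 by exact: unit.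
have d0 : (0 < d)%N by exact: leq_trans d2.
have [A0 _] := @ball_volume_Asurf R d d0.
have D0 := kernel_discriminant_gt0 d _ _ _ _ r1 r2 e1 e2.
have p0 : 0 < 1 - rho1 ^+ 2 by move: r1 => /andP[? ?]; nra.
have q0 : 0 < 1 - rho2 ^+ 2 by move: r2 => /andP[? ?]; nra.
have pq0 : 0 < 1 - rho1 ^+ 2 * rho2 ^+ 2.
  by have := sqr_ge0 rho1; have := sqr_ge0 rho2; nra.
rewrite -sqrt_powR ?(ltW D0)//.
set D := (_ + _ - _) in D0 *.
have sD0 : 0 < Num.sqrt D ^+ d by rewrite exprn_gt0// sqrtr_gt0.
set A := @Asurf R d in A0 *.
(* For unit vectors [|eta1 - rho1 xi| = |xi - rho1 eta1|], so the likelihood is a Poisson kernel in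
   [xi] with pole direction [eta1]. *)
have likE xi : enorm xi = 1 ->
    lik xi eta1 = A^-1 * ((1 - rho1 ^+ 2) / enorm (subsc xi rho1 eta1) ^+ d).
  move=> x1; rewrite /lik /exit_density /enorm !dotp_subsc// ?unit//.
  by rewrite (dotpC eta1).
(* Since [D = |eta1 - rho1 rho2 eta2|^2], the marginal is again an exit density, with radius
   [rho1 rho2] and direction [eta2]: the semigroup property of the Poisson kernel. *)
have mE : marginal_density lik prior eta1 =
    (A^-1 * (1 - rho1 ^+ 2 * rho2 ^+ 2) / Num.sqrt D ^+ d)%:E.
  transitivity ((A ^- 2 * (1 - rho1 ^+ 2) * (1 - rho2 ^+ 2))%:E * sphere_int (fun x =>
     ((enorm (subsc x rho1 eta1) * enorm (subsc x rho2 eta2)) ^- d)%:E))%E.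
    rewrite -sphere_intZl.
    - apply: eq_sphere_int => x x1; rewrite likE// /prior /exit_density -EFinM.
      rewrite -/A (exprMn _ (enorm (subsc x rho1 eta1))) -[A ^- 2]exprVn expr2.
      by rewrite (invfM (enorm (subsc x rho1 eta1) ^+ d)); congr EFin; ring.
    - by rewrite lee_fin !mulr_ge0 ?invr_ge0 ?exprn_ge0 ?(ltW A0) ?(ltW p0) ?(ltW q0).
    - by move=> x _; rewrite lee_fin invr_ge0 exprn_ge0// mulr_ge0// enorm_ge0.
    - exact: measurable_kernel_product.
  rewrite sphere_int_kernels// -EFinM; congr EFin; rewrite -/D -/A; field.
  by rewrite !gt_eqF.
rewrite /posterior_density mE; split.
  by rewrite lte_fin ltry andbT !mulr_gt0 ?invr_gt0.
move=> xi /[!inE] x1; rewrite likE// /prior /exit_density -/A.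
have x1' := unit _ x1.
have n1 : 0 < enorm (subsc xi rho1 eta1) ^+ d.
  by rewrite exprn_gt0// sqrtr_gt0 dotp_subsc// kernel_gt0.
have n2 : 0 < enorm (subsc xi rho2 eta2) ^+ d.
  by rewrite exprn_gt0// sqrtr_gt0 dotp_subsc// kernel_gt0.
rewrite /=; field; rewrite exprMn.
by rewrite (gt_eqF n1) (gt_eqF n2) (gt_eqF pq0) (gt_eqF A0) (gt_eqF sD0).
Qed.
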